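(* There is a sufficiently large absolute constant $C_0$ such that the following holds. Assume $1\le p\le 2$ and $W\ge (n/\delta)^{C_0}$. Then any randomized turnstile streaming algorithm that, on every unit update turnstile stream on $\mathbb Z^n$ of length at most $W$, outputs a $(1+\epsilon)$-approximation to the $L_p$ norm $\|x\|_p$ of the final frequency vector $x$ with success probability at least $1-\delta$ must use $\Omega\left(\min\{\epsilon^{-2}\log(1/\delta),n\}\cdot\log W\right)$ bits of space.
   Context: A unit update turnstile stream is a sequence of updates $(i,\Delta)$, $i\in[n]$, $\Delta\in\{\pm1\}$, each adding $\Delta$ to coordinate $i$ of a vector starting at $0$; the final frequency vector is the vector at the end. A randomized streaming algorithm using $S$ bits is a public-coin family of deterministic streaming algorithms each with at most $2^S$ memory states; the random seed is not counted toward the space, and the success probability is over the seed for each fixed stream.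
   Formalization: The ranges 0<ε<1, 0<δ<1/2, n≥1 are made explicit (for δ near 1 the claim fails, e.g. n=1, W=2, with a zero-space guess), and a (1+ε)-approximation z of v means v/(1+ε) ≤ z ≤ (1+ε)v. *)

(* Defs.v *)
From HB Require Import structures.
From mathcomp Require Import all_boot all_order all_algebra.
From mathcomp Require Import all_classical all_reals all_analysis.

Set Implicit Arguments.
Unset Strict Implicit.
Unset Printing Implicit Defensive.

Import Order.TTheory GRing.Theory Num.Theory.
Import numFieldNormedType.Exports.

Local Open Scope classical_set_scope.
Local Open Scope ring_scope.

(* The pair (i, b) is the update (i, Delta) with Delta = 1 if b, else -1. *)
Definition update (n : nat) : Type := ('I_n * bool)%type.

Definition increment (b : bool) : int := if b then 1 else - 1.

Definition apply_update (n : nat) (x : 'rV[int]_n) (u : update n) : 'rV[int]_n :=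
  x + increment u.2 *: delta_mx 0 u.1.

Definition frequency (n : nat) (s : seq (update n)) : 'rV[int]_n :=
  foldl (@apply_update n) 0 s.

Definition Lp_norm (R : realType) (p : R) (n : nat) (x : 'rV[int]_n) : R :=
  (\sum_(i < n) `|(x 0 i)%:~R| `^ p) `^ p^-1.

Record det_alg (R : realType) (n : nat) := DetAlg {
  state : finType;
  init : state;
  step : state -> update n -> state;
  output : state -> R }.

Definition run (R : realType) (n : nat) (A : det_alg R n)
    (s : seq (update n)) : R :=
  output (foldl (@step R n A) (init A) s).

(* A public-coin algorithm: a family of deterministic algorithms indexed by a
   random seed in an arbitrary probability space; measurability only says that
   the output on each fixed stream is a random variable. *)
Record rand_alg (R : realType) (n : nat) := RandAlg {
  seed_display : measure_display;
  seed : measurableType seed_display;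
  seed_prob : probability seed R;
  alg : seed -> det_alg R n;
  run_measurable : forall s : seq (update n),
    measurable_fun [set: seed] (fun w => run (alg w) s) }.

Definition uses_bits (R : realType) (n : nat) (A : rand_alg R n) (S : nat) : Prop :=
  forall w : seed A, (#|state (alg w)| <= 2 ^ S)%N.

(* z is within a factor 1 + eps of v; in particular z = 0 when v = 0. *)
Definition approximates (R : realType) (eps v z : R) : Prop :=
  v / (1 + eps) <= z <= (1 + eps) * v.

Definition estimates_Lp (R : realType) (n : nat) (A : rand_alg R n)
    (p eps delta : R) (W : nat) : Prop :=
  forall s : seq (update n), (size s <= W)%N ->
    ((1 - delta)%:E <=
      seed_prob A [set w | approximates eps (Lp_norm p (frequency s))
                             (run (alg w) s)])%E.

(* Main.v *)
(** The proof encodes a long message into the frequency vector and decodes it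
    from the memory state (one-way augmented indexing).  The vector is a sum over
    about log W scales [4^s], each carrying L symbols of log(1/delta) bits; having
    decoded the scales above [s], one subtracts them, subtracts a query vector at
    scale [s], and reads the norm.  A symbol [u] is a codeword in {-1,1}^n, the L
    codewords of a scale are multiplied by independent random sign vectors and
    superposed by taking the sign of their sum coordinatewise, so that each of
    them keeps correlation about 1/sqrt L with the result.  Querying a codeword
    times its sign vector shifts the p-th power of the norm by a relative amount
    1/sqrt L, which is visible as soon as L is at most a constant over eps^2,
    while Hoeffding's inequality over the n coordinates, which also absorbs the
    lower scales, is strong enough when n >= C L log(1/delta).  Since delta may be
    close to 1/2, for large delta only one query per symbol is affordable: there
    the code is a "thermometer" whose many levels are separated by one query.
    Two degenerate regimes (n or eps^-2 log(1/delta) bounded; eps bounded below)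
    are treated by geometric digits on one coordinate and by L = 1. *)

Require Import Defs.
From HB Require Import structures.
From mathcomp Require Import all_boot all_order all_algebra.
From mathcomp Require Import all_classical all_reals all_analysis.
From mathcomp Require Import measurable_realfun perm.
From mathcomp Require Import zify ring lra.

Set Implicit Arguments.
Unset Strict Implicit.
Unset Printing Implicit Defensive.

Import Order.TTheory GRing.Theory Num.Theory.
Import numFieldNormedType.Exports.

Local Open Scope classical_set_scope.
Local Open Scope ring_scope.

(** * One-way decoding *)

(* A message is determined by the memory state, the set of positions that are
   decoded correctly and its values at the other positions. *)
Lemma decodable_fiber_card (T L : nat) (U St : finType)
    (st : {ffun 'I_T * 'I_L -> U} -> St)
    (suc : {ffun 'I_T * 'I_L -> U} -> {set 'I_T * 'I_L}) :
  (forall M M', st M = st M' -> forall (s : 'I_T) (j : 'I_L),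
     (forall (s' : 'I_T) (j' : 'I_L), (s < s')%N -> M (s', j') = M' (s', j')) ->
     (s, j) \in suc M -> (s, j) \in suc M' -> M (s, j) = M' (s, j)) ->
  forall (z : St) (G : {set 'I_T * 'I_L}),
  (#|[set M : {ffun 'I_T * 'I_L -> U} | (st M == z) && (suc M == G)]%SET| <= #|U| ^ #|~: G|)%N.
Proof.
move=> Hdec z G.
case: (pickP (mem [set M : {ffun 'I_T * 'I_L -> U} | (st M == z) && (suc M == G)]%SET)) => [M0 HM0|Hnone]; last first.
  by rewrite (eq_card0 Hnone).
(* Overwriting the positions of [G] by the values of one member [M0] of the fiber loses nothing, so
   the fiber embeds in the functions that are free only off [G]. *)
have Hinj : {in [set M : {ffun 'I_T * 'I_L -> U} | (st M == z) && (suc M == G)]%SET &,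
    injective (fun M : {ffun 'I_T * 'I_L -> U} =>
      [ffun x => if x \in G then M0 x else M x])}.
  move=> M M'; rewrite !inE => /andP[/eqP sM /eqP gM] /andP[/eqP sM' /eqP gM'] E.
  have off x : x \notin G -> M x = M' x.
    by move=> /negPf nG; move/ffunP: E => /(_ x); rewrite !ffunE nG.
  (* Decoding a scale presupposes all higher ones, hence an induction that runs down from the top
     scale. *)
  have key k : forall (s : 'I_T) j, (T - s <= k)%N -> M (s, j) = M' (s, j).
    elim: k => [|k IH] s j; first by have := ltn_ord s; lia.
    move=> le; case: (boolP ((s, j) \in G)) => [inG|/off //].
    apply: Hdec; rewrite ?sM ?sM' ?gM ?gM' // => s' j' lt.
    by apply: IH; have := ltn_ord s'; lia.
  by apply/ffunP => -[s j]; exact: (key T s j (leq_subr _ _)).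
rewrite -(card_in_imset Hinj).
have -> : (#|U| ^ #|~: G| = #|family (fun x => if x \in G then pred1 (M0 x) else predT)|)%N.
  rewrite card_family foldrE big_map big_enum /= -prod_nat_const.
  rewrite [RHS](bigID (mem (~: G))) /= [X in (_ * X)%N]big1 ?muln1.
    by apply: eq_bigr => x; rewrite inE => /negPf ->.
  by move=> x; rewrite inE negbK => ->; rewrite card1.
apply: subset_leq_card; apply/fintype.subsetP => f /imsetP[M _ ->].
apply/familyP => x; rewrite ffunE; case: ifP => // _; exact: eqxx.
Qed.

(** A counting argument with [N = T * L]. On average at most 5/8 of the positions are undecoded, so
    by Markov at least 2/7 of the [2 ^ (8 a N)] messages leave at most 7/8 of them undecoded. Each
    pair of a state and one of the [2 ^ N] success sets accounts for at most [2 ^ (7 a N)] such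
    messages. *)
Lemma decoding_lower_bound (T L a : nat) (U St : finType)
    (st : {ffun 'I_T * 'I_L -> U} -> St)
    (suc : {ffun 'I_T * 'I_L -> U} -> {set 'I_T * 'I_L}) :
  #|U| = (2 ^ (8 * a))%N ->
  (forall M M', st M = st M' -> forall (s : 'I_T) (j : 'I_L),
     (forall (s' : 'I_T) (j' : 'I_L), (s < s')%N -> M (s', j') = M' (s', j')) ->
     (s, j) \in suc M -> (s, j) \in suc M' -> M (s, j) = M' (s, j)) ->
  (8 * \sum_(M : {ffun 'I_T * 'I_L -> U}) #|~: suc M|
     <= 5 * (T * L * #|{ffun 'I_T * 'I_L -> U}|))%N ->
  (2 ^ (a * (T * L)) <= 4 * (#|St| * 2 ^ (T * L)))%N.
Proof.
move=> cU Hdec Hsum.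
set N := (T * L)%N in Hsum *.
have [N0|Npos] := posnP N.
  rewrite N0 muln0 expn0 muln1.
  have [E|//] := posnP #|St|; last by rewrite muln_gt0.
  have /card_gt0P[u0 _] : (0 < #|U|)%N by rewrite cU expn_gt0.
  by have := card0_eq E (st [ffun => u0]).
have cM : #|{ffun 'I_T * 'I_L -> U}| = (2 ^ (8 * a * N))%N.
  by rewrite card_ffun card_prod !card_ord cU -expnM.
pose F := [set M : {ffun 'I_T * 'I_L -> U} | (8 * #|~: suc M| <= 7 * N)%N]%SET.
have HF : (7 * #|~: F| <= 5 * #|{ffun 'I_T * 'I_L -> U}|)%N.
  have H1 : (\sum_(M in ~: F) 7 * N <= 8 * \sum_(M : {ffun 'I_T * 'I_L -> U}) #|~: suc M|)%N.
    rewrite big_distrr /= [leqRHS](bigID (mem (~: F))) /=.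
    apply: leq_trans (leq_addr _ _); apply: leq_sum => M; rewrite !inE -ltnNge; exact: ltnW.
  rewrite sum_nat_const in H1.
  rewrite -(leq_pmul2r Npos); lia.
have HF2 : (2 * #|{ffun 'I_T * 'I_L -> U}| <= 7 * #|F|)%N.
  by move: HF; rewrite -(cardsC F); move: #|F| #|~: F| => f g; lia.
have HF3 : (#|F| <= #|St| * 2 ^ N * 2 ^ (7 * a * N))%N.
  rewrite -sum1_card (partition_big (fun M => (st M, suc M)) predT) //=.
  apply: (@leq_trans (\sum_(j : St * {set 'I_T * 'I_L}) 2 ^ (7 * a * N))%N); last first.
    rewrite sum_nat_const card_prod leq_mul2r; apply/orP; right.
    have -> : #|{set 'I_T * 'I_L}| = (2 ^ N)%N.
      by rewrite -cardsT -powersetT card_powerset cardsT card_prod !card_ord.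
    exact: leqnn.
  apply: leq_sum => -[z G] _; rewrite sum1_card.
  case: (leqP (8 * #|~: G|) (7 * N)) => [le|gt].
    apply: (@leq_trans (#|U| ^ #|~: G|)%N).
      apply: leq_trans (decodable_fiber_card Hdec z G).
      apply: subset_leq_card; apply/fintype.subsetP => M; rewrite !inE.
      by case/andP=> _; rewrite xpair_eqE.
    by rewrite cU -expnM leq_exp2l //; nia.
  rewrite eq_card0 // => M; apply/negP; rewrite !inE /= => /andP[le].
  by rewrite xpair_eqE => /andP[_ /eqP E]; move: le; rewrite inE E leqNgt gt.
rewrite cM in HF2.
have E : (8 * a * N = a * N + 7 * a * N)%N by lia.
have pos : (0 < 2 ^ (7 * a * N))%N by rewrite expn_gt0.
rewrite E expnD in HF2.
rewrite -(leq_pmul2r pos).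
move: HF2 HF3.
set x := (2 ^ (a * N))%N; set y := (2 ^ (7 * a * N))%N; set q := (#|St| * 2 ^ N)%N; set f := #|F|.
nia.
Qed.

Lemma frequencyE (n : nat) (s : seq (update n)) :
  frequency s = \sum_(u <- s) increment u.2 *: delta_mx 0 u.1.
Proof.
suff H x : foldl (@apply_update n) x s =
    x + \sum_(u <- s) increment u.2 *: delta_mx 0 u.1 by rewrite /frequency H add0r.
elim: s x => [|u s IH] x /=; first by rewrite big_nil addr0.
by rewrite IH /apply_update big_cons addrA.
Qed.

Lemma frequency_cat (n : nat) (s t : seq (update n)) :
  frequency (s ++ t) = frequency s + frequency t.
Proof. by rewrite !frequencyE big_cat. Qed.

Definition stream_of (n : nat) (z : 'rV[int]_n) : seq (update n) :=
  flatten [seq nseq (absz (z 0 i)) (i, 0 <= z 0 i) | i <- enum 'I_n].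

Lemma frequency_stream_of (n : nat) (z : 'rV[int]_n) :
  frequency (stream_of z) = z.
Proof.
rewrite frequencyE big_flatten big_map big_enum /=.
rewrite [RHS]row_sum_delta; apply: eq_bigr => i _.
rewrite big_nseq /= iter_addr_0 scalerMnl; congr (_ *: _).
by rewrite /increment; case: (leP 0 (z 0 i)) => h /=; lia.
Qed.

Lemma size_stream_of (n : nat) (z : 'rV[int]_n) (b : nat) :
  (forall i, (absz (z 0%R i) <= b)%N) -> (size (stream_of z) <= n * b)%N.
Proof.
move=> hb; rewrite size_flatten /shape -map_comp sumnE big_map big_enum /=.
rewrite -[X in (X * b)%N]card_ord -sum_nat_const; apply: leq_sum => i _.
by rewrite size_nseq.
Qed.

Lemma exists_few_events (R : realType) (d : measure_display)
    (Sd : measurableType d) (P : probability Sd R) (I : finType)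
    (E : I -> set Sd) (delta : R) :
  (forall i, measurable (E i)) -> (forall i, (P (E i) <= delta%:E)%E) ->
  exists w, (\sum_i `[< E i w >])%:R <= delta * #|I|%:R.
Proof.
move=> mE hE; apply: contrapT => /forallNP hN.
have I0 : 0 <= delta * #|I|%:R.
  have [/card0_eq I0|/card_gt0P[i _]] := posnP #|I|.
    by rewrite eq_card0 // mulr0.
  by apply: mulr_ge0 => //; rewrite -lee_fin; apply: le_trans (hE i).
(* Counts are integers: exceeding the bound everywhere means being at least this constant, which is
   strictly larger than the bound, so a non-strict comparison of integrals suffices. *)
set c := (Num.truncn (delta * #|I|%:R)).+1.
have hc w : (c <= \sum_i `[< E i w >])%N.
  rewrite /c -(ltr_nat R); apply: (@le_lt_trans _ _ (delta * #|I|%:R)); first by rewrite truncn_le.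
  by rewrite ltNge; apply/negP; exact: hN.
have : (c%:R%:E <= \int[P]_w \sum_(i : I) (\1_(E i) w)%:E)%E.
  rewrite -[leLHS]mule1 -(@probability_setT _ _ _ P) -integral_cst //.
  apply: ge0_le_integral => //=.
  - by apply: emeasurable_sum => i; exact/measurable_EFinP/measurable_indic.
  - move=> w _; rewrite sumEFin lee_fin.
    rewrite (eq_bigr (fun i => (`[< E i w >] : nat)%:R)).
      by rewrite -natr_sum ler_nat.
    by move=> i _; rewrite indicE /=; congr (nat_of_bool _)%:R; apply: asbool_equiv_eq; split=> /set_mem.
have mI i : measurable_fun setT (fun w => (\1_(E i) w)%:E : \bar R).
  exact/measurable_EFinP/measurable_indic.
rewrite (ge0_integral_sum P measurableT mI); last by move=> i w _; rewrite lee_fin.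
under eq_bigr => i _ do rewrite integral_indic// setIT.
move=> h; have : (c%:R%:E <= (delta * #|I|%:R)%:E :> \bar R)%E.
  apply: (le_trans h); apply: (@le_trans _ _ (\sum_(i : I) delta%:E)%E).
    by apply: lee_sum => i _; exact: hE.
  by rewrite sumEFin sumr_const mulr_natr lexx.
by rewrite lee_fin leNgt /c truncnS_gt.
Qed.

Lemma exists_le_average (I : finType) (f : I -> nat) (c : nat) :
  (0 < #|I|)%N -> (\sum_i f i <= c * #|I|)%N -> exists i, (f i <= c)%N.
Proof.
move=> I0 hs; apply: contrapT => /forallNP hN.
have : (\sum_(i : I) c.+1 <= \sum_i f i)%N.
  by apply: leq_sum => i _; rewrite ltnNge; apply/negP; exact: hN.
rewrite sum_nat_const => h; have := leq_trans h hs.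
by rewrite mulnC leq_pmul2r // ltnn.
Qed.

Definition slice (T L : nat) (U : finType) (M : {ffun 'I_T * 'I_L -> U})
    (s : 'I_T) : {ffun 'I_L -> U} := [ffun j => M (s, j)].

(** The vector whose norm is read: scales above [s] have been decoded and subtracted, while those
    below [s] remain as noise. *)
Definition residual (n T L : nat) (U : finType)
    (enc : 'I_T -> {ffun 'I_L -> U} -> 'rV[int]_n) (q : 'rV[int]_n)
    (M : {ffun 'I_T * 'I_L -> U}) (s : 'I_T) : 'rV[int]_n :=
  \sum_(s' < T | (s' <= s)%N) enc s' (slice M s') - q.

Lemma sum_expn_le (B T : nat) : (1 < B)%N -> (\sum_(s < T) B ^ s <= B ^ T)%N.
Proof.
move=> hB; elim: T => [|T IH]; first by rewrite big_ord0.
rewrite big_ord_recr /= expnS; apply: leq_trans (_ : 2 * B ^ T <= _)%N.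
  by rewrite mul2n -addnn leq_add2r.
by rewrite leq_mul2r hB orbT.
Qed.

Lemma absz_sum_le (I : finType) (P : pred I) (f : I -> int) :
  (absz (\sum_(i | P i) f i)%R <= \sum_(i | P i) absz (f i))%N.
Proof.
apply: (big_ind2 (fun (x : int) y => (absz x <= y)%N)) => //.
by move=> x1 y1 x2 y2 h1 h2; lia.
Qed.

(* Lower bound for one-way augmented indexing: the holder of the memory state
   knows every scale above the one queried, so it can subtract them.  The set
   [Good s j u g] collects the norms that answer the query [g] at position
   [(s, j)] when the symbol there is [u]. *)
Lemma augmented_indexing_bound (R : realType) (n T L a D B W S : nat)
    (A : rand_alg R n) (p eps delta : R) (Om U Ga : finType)
    (enc : Om -> 'I_T -> {ffun 'I_L -> U} -> 'rV[int]_n)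
    (qry : Om -> 'I_T -> 'I_L -> Ga -> 'rV[int]_n)
    (Good : 'I_T -> 'I_L -> U -> Ga -> set R) :
  (4 <= a)%N -> #|U| = (2 ^ (8 * a))%N -> (0 < #|Om|)%N -> (1 < B)%N ->
  (forall om s m i, (absz (enc om s m 0%R i) <= D * B ^ s)%N) ->
  (forall om s j g i, (absz (qry om s j g 0%R i) <= D * B ^ s)%N) ->
  (2 * n * D * B ^ T <= W)%N ->
  #|Ga|%:R * delta <= 1 / 2 ->
  (forall s j u u', u != u' -> exists g, forall x x',
     Good s j u g x -> Good s j u' g x' -> forall z,
     approximates eps x z -> approximates eps x' z -> False) ->
  (forall (M : {ffun 'I_T * 'I_L -> U}) s j, (8 * #|[set om | ~~ `[< forall g,
     Good s j (M (s, j)) g (Lp_norm p (residual (enc om) (qry om s j g) M s)) >]]%SET|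
     <= #|Om|)%N) ->
  uses_bits A S -> estimates_Lp A p eps delta W -> (a * (T * L) <= 4 * S)%N.
Proof.
move=> ha cU Om0 hB henc hqry hW hdelta hsep hconc hbits hest.
have [->|N0] := posnP (T * L)%N; first by rewrite muln0.
(* [alice] writes the whole message. [bob] depends on [M] only through the scales above [s], so
   whoever has decoded those can continue from the memory state. *)
pose alice om (M : {ffun 'I_T * 'I_L -> U}) := \sum_s enc om s (slice M s).
pose bob om (M : {ffun 'I_T * 'I_L -> U}) (s : 'I_T) j g :=
  - (\sum_(s' < T | ~~ (s' <= s)%N) enc om s' (slice M s')) - qry om s j g.
pose str om M s j g := stream_of (alice om M) ++ stream_of (bob om M s j g).
have fstr om M s j g : frequency (str om M s j g) =
    residual (enc om) (qry om s j g) M s.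
  rewrite frequency_cat !frequency_stream_of /alice /bob /residual.
  by rewrite (bigID (fun s' : 'I_T => (s' <= s)%N)) /= addrA addrK.
have sstr om M s j g : (size (str om M s j g) <= W)%N.
  rewrite size_cat; apply: leq_trans hW.
  have -> : (2 * n * D * B ^ T = n * (D * B ^ T) + n * (D * B ^ T))%N by ring.
  apply: leq_add; apply: size_stream_of => i.
    rewrite /alice summxE; apply: leq_trans (absz_sum_le _ _) _.
    apply: (@leq_trans (\sum_(s0 < T) D * B ^ s0)%N).
      by apply: leq_sum => s0 _; exact: henc.
    by rewrite -big_distrr /= leq_mul2l sum_expn_le ?orbT.
  rewrite /bob mxE [X in (absz (X + _)%R <= _)%N]mxE [X in (absz (_ + X)%R <= _)%N]mxE summxE.
  apply: (@leq_trans (\sum_(s' < T | ~~ (s' <= s)%N) D * B ^ s' + D * B ^ s)%N).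
    have h1 := hqry om s j g i.
    have h2 : (absz (\sum_(s' < T | ~~ (s' <= s)%N) enc om s' (slice M s') 0%R i)%R
        <= \sum_(s' < T | ~~ (s' <= s)%N) D * B ^ s')%N.
      apply: leq_trans (absz_sum_le _ _) _.
      by apply: leq_sum => s0 _; exact: henc.
    move: h1 h2; move: (\sum_(s' < T | _) enc _ _ _ _ _) (qry om s j g 0 i) => x y.
    move: (\sum_(s' < T | _) _)%N (D * B ^ s)%N => x' y'; lia.
  apply: (@leq_trans (\sum_(s0 < T) D * B ^ s0)%N); last first.
    by rewrite -big_distrr /= leq_mul2l sum_expn_le ?orbT.
  rewrite [leqRHS](bigID (fun s' : 'I_T => ~~ (s' <= s)%N)) /= leq_add2l.
  by rewrite (bigD1 s) ?negbK // leq_addr.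
pose Ind := (Om * {ffun 'I_T * 'I_L -> U} * ('I_T * 'I_L) * Ga)%type.
pose Bad (x : Ind) : set (seed A) :=
  let: (om, M, (s, j), g) := x in
  ~` [set w | approximates eps
        (Lp_norm p (frequency (str om M s j g))) (run (alg w) (str om M s j g))].
have mGood om M s j g : measurable [set w : seed A | approximates eps
        (Lp_norm p (frequency (str om M s j g))) (run (alg w) (str om M s j g))].
  set v := Lp_norm _ _.
  rewrite (_ : [set w | _] = [set: seed A] `&`
    (fun w => run (alg w) (str om M s j g)) @^-1` `[v / (1 + eps), (1 + eps) * v]).
    by apply: run_measurable => //; exact: measurable_itv.
  by rewrite setTI; apply/seteqP; split=> w; rewrite /approximates /= in_itv.
have mBad x : measurable (Bad x).
  by case: x => [[[om M] [s j]] g]; apply: measurableC; exact: mGood.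
have pBad x : (seed_prob A (Bad x) <= delta%:E)%E.
  case: x => [[[om M] [s j]] g]; rewrite /Bad probability_setC //.
  have := hest _ (sstr om M s j g).
  by rewrite -[seed_prob A _]fineK ?fin_num_measure // -EFinB !lee_fin; lra.
(* First one seed is fixed that is good on average over masks, messages, positions and queries; the
   mask [om] is fixed afterwards by a second average. *)
have [w [bad hbad hw]] : exists w, exists2 bad : Ind -> bool,
    (forall i, ~~ bad i -> ~ Bad i w) & (\sum_i bad i)%:R <= delta * #|{: Ind}|%:R.
  have [w hw] := exists_few_events mBad pBad; exists w.
  by exists (fun i => `[< Bad i w >]) => // i /asboolPn.
have [vbad hvbad hvconc] : exists2 vbad : Om -> {ffun 'I_T * 'I_L -> U} -> 'I_T * 'I_L -> bool,
    (forall om M x, ~~ vbad om M x -> forall g, Good x.1 x.2 (M x) g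
       (Lp_norm p (residual (enc om) (qry om x.1 x.2 g) M x.1))) &
    forall M x, (8 * \sum_om vbad om M x <= #|Om|)%N.
  exists (fun om (M : {ffun 'I_T * 'I_L -> U}) x => ~~ `[< forall g, Good x.1 x.2 (M x) g
     (Lp_norm p (residual (enc om) (qry om x.1 x.2 g) M x.1)) >]).
    by move=> om M x /negPn/asboolP.
  move=> M [s j]; apply: leq_trans (hconc M s j).
  rewrite leq_mul2l /= -sum1_card [leqRHS]big_mkcond /=.
  by apply: leq_sum => om _; rewrite finset.in_set /=; case: (~~ _).
pose suc om M := [set x | ~~ vbad om M x & [forall g, ~~ bad (om, M, x, g)]]%SET.
have csuc om M : (#|~: suc om M| <=
    \sum_x (vbad om M x + \sum_g bad (om, M, x, g)))%N.
  rewrite -sum1_card big_mkcond /=; apply: leq_sum => x _.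
  rewrite !inE; case: (vbad om M x) => //=.
  case: (boolP [forall g, _]) => //= /forallPn[g]; rewrite negbK => h.
  by rewrite (bigD1 g) //= h.
(* The budget 5/8 is 1/8 for positions where some norm misses [Good], plus 1/2 for wrong outputs, by
   a union bound over the queries. *)
have [om hom] : exists om, (8 * \sum_M #|~: suc om M| <=
    5 * (T * L * #|{ffun 'I_T * 'I_L -> U}|))%N.
  apply: exists_le_average => //.
  apply: (@leq_trans (\sum_om 8 * \sum_M
     \sum_x (vbad om M x + \sum_g bad (om, M, x, g)))%N).
    by apply: leq_sum => om _; rewrite leq_mul2l /=; apply: leq_sum => M _.
  have h1 : (2 * \sum_(i : Ind) bad i <=
      #|Om| * #|{ffun 'I_T * 'I_L -> U}| * (T * L))%N.
    rewrite -(ler_nat R) natrM; apply: (le_trans (ler_wpM2l _ hw)) => //.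
    rewrite !card_prod !card_ord !natrM.
    have := ler_wpM2l (ler0n R (#|Om| * #|{ffun 'I_T * 'I_L -> U}| * (T * L))) hdelta.
    rewrite !natrM; lra.
  have h2 : (8 * \sum_om \sum_M \sum_x vbad om M x <=
      #|Om| * #|{ffun 'I_T * 'I_L -> U}| * (T * L))%N.
    rewrite exchange_big /=; under eq_bigr => M _ do rewrite exchange_big /=.
    rewrite big_distrr /=.
    apply: (@leq_trans (\sum_(M : {ffun 'I_T * 'I_L -> U}) T * L * #|Om|)%N).
      apply: leq_sum => M _; rewrite big_distrr /=.
      apply: (@leq_trans (\sum_(x : 'I_T * 'I_L) #|Om|)%N).
        by apply: leq_sum => x _; exact: hvconc.
      by rewrite sum_nat_const card_prod !card_ord.
    by rewrite sum_nat_const; apply/eq_leq; ring.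
  rewrite -big_distrr /=.
  have -> : (\sum_om \sum_M \sum_x (vbad om M x + \sum_g bad (om, M, x, g)) =
     \sum_om \sum_M \sum_x vbad om M x + \sum_(i : Ind) bad i)%N.
    rewrite [X in (_ + X)%N](_ : _ =
      \sum_om \sum_M \sum_x \sum_g bad (om, M, x, g))%N.
      rewrite -big_split /=; apply: eq_bigr => om _.
      rewrite -big_split /=; apply: eq_bigr => M _.
      by rewrite -big_split.
    by rewrite !pair_big /=; apply: eq_bigr => -[[[om M] x] g] _.
  move: h1 h2; set x := (\sum_(i : Ind) _)%N; set y := (\sum_om _)%N.
  move: #|Om| #|{ffun 'I_T * 'I_L -> U}| (T * L)%N x y => c1 c2 c3 x y; lia.
have h : (2 ^ (a * (T * L)) <= 4 * (#|state (alg w)| * 2 ^ (T * L)))%N.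
  apply: (@decoding_lower_bound T L a U (state (alg w))
    (fun M => foldl (@step R n (alg w)) (init (alg w)) (stream_of (alice om M)))
    (suc om) cU _ hom) => M M' hst s j hup.
  rewrite !finset.in_set => /andP[/hvbad g1 /forallP b1] /andP[/hvbad g2 /forallP b2].
  apply/eqP/negPn/negP => hne; have [g hg] := hsep s j _ _ hne.
  apply: (hg _ _ (g1 g) (g2 g) (run (alg w) (str om M s j g))).
    by have /hbad/contrapT := b1 g; rewrite /= fstr.
  have /hbad/contrapT := b2 g; rewrite /= fstr.
  (* Equal states and equal higher scales make both runs produce one output, which the separating
     query [g] forbids. *)
  suff -> : run (alg w) (str om M' s j g) = run (alg w) (str om M s j g) by [].
  rewrite /run /str !foldl_cat hst; congr (output (foldl _ _ (stream_of _))).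
  rewrite /bob; congr (- _ - _); apply: eq_bigr => s' hs'; congr (enc _ _ _).
  by apply/ffunP => j'; rewrite !ffunE hup // ltnNge.
have {}h : (2 ^ (a * (T * L)) <= 2 ^ (2 + (S + T * L)))%N.
  apply: leq_trans h _; rewrite !expnD leq_mul2l /= leq_mul2r.
  by apply/orP; right; exact: hbits.
rewrite leq_exp2l // in h.
(* With [N = T * L] this says [a N <= 2 + S + N]; the claim follows since [(3 a - 4) N >= 8], which
   uses [a >= 4] and [N >= 1]. *)
by move: (T * L)%N N0 h => N N0 h; nia.
Qed.

(** * Codes and the number of scales *)

Definition hdist (n : nat) (f h : {ffun 'I_n -> bool}) : nat :=
  #|[set i | f i != h i]%SET|.

Lemma hdistC (n : nat) (f h : {ffun 'I_n -> bool}) : hdist f h = hdist h f.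
Proof. by rewrite /hdist; apply: eq_card => i; rewrite !inE eq_sym. Qed.

(* Each word [h] is weighted by 3 to the number of its agreements with [f]. *)
Lemma hamming_ball_card (n b : nat) (f : {ffun 'I_n -> bool}) :
  (4 * b <= n)%N ->
  (#|[set h | 16 * hdist f h <= n]%SET| * 2 ^ b <= 2 ^ n)%N.
Proof.
move=> hb.
have wE h : (3 ^ (n - hdist f h) = \prod_(i < n) (if f i == h i then 3 else 1))%N.
  rewrite -big_mkcond /= prod_nat_const; congr (3 ^ _)%N.
  rewrite /hdist -[X in (X - _)%N](card_ord n) -(cardsC [set i | f i != h i]%SET).
  by rewrite addnC addnK; apply: eq_card => i; rewrite !inE negbK.
have total : (\sum_(h : {ffun 'I_n -> bool}) 3 ^ (n - hdist f h) = 4 ^ n)%N.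
  under eq_bigr => h _ do rewrite wE.
  rewrite -(bigA_distr_bigA (fun i c => if f i == c then 3 else 1))%N /=.
  rewrite (eq_bigr (fun=> 4%N)); first by rewrite prod_nat_const card_ord.
  by move=> i _; rewrite big_bool /=; case: (f i).
(* Taking 16th powers, with [b] at most [n / 4] and at least [15 n / 16] agreements, reduces this to
   [2 ^ 4 <= 3 ^ 3]. *)
have low h : (16 * hdist f h <= n)%N -> (2 ^ (n + b) <= 3 ^ (n - hdist f h))%N.
  move=> hd; rewrite -(@leq_exp2r _ _ 16) // -!expnM.
  apply: (@leq_trans (2 ^ (20 * n))%N); first by rewrite leq_exp2l //; lia.
  apply: (@leq_trans (3 ^ (15 * n))%N); last by rewrite leq_exp2l //; lia.
  have [->|n0] := posnP n; first by rewrite !muln0.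
  have -> : (20 * n = 4 * (5 * n))%N by ring.
  have -> : (15 * n = 3 * (5 * n))%N by ring.
  by rewrite (expnM 2 4) (expnM 3 3) leq_exp2r ?muln_gt0 ?n0.
have : (#|[set h | 16 * hdist f h <= n]%SET| * 2 ^ (n + b) <= 4 ^ n)%N.
  rewrite -total -sum_nat_const big_mkcond /=; apply: leq_sum => h _.
  by rewrite inE; case: ifP => // /low.
have -> : (4 ^ n = 2 ^ n * 2 ^ n)%N by rewrite -expnMn.
rewrite expnD mulnCA mulnC leq_pmul2r ?expn_gt0 //.
Qed.

(** Greedy choice: the balls around fewer than [2 ^ b] words, each of at most [2 ^ (n - b)]
    elements, cannot cover the cube, so another word can be added. *)
Lemma gilbert_varshamov (n b K : nat) : (4 * b <= n)%N -> (K <= 2 ^ b)%N ->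
  exists H : 'I_K -> {ffun 'I_n -> bool},
    forall u u', u != u' -> (n < 16 * hdist (H u) (H u'))%N.
Proof.
move=> hb hK.
suff : forall k, (k <= K)%N -> exists s : seq {ffun 'I_n -> bool},
    size s = k /\ forall i j, (i < k)%N -> (j < k)%N -> i != j ->
      (n < 16 * hdist (nth [ffun=> false] s i) (nth [ffun=> false] s j))%N.
  move=> /(_ K (leqnn _))[s [_ hs]].
  by exists (fun u : 'I_K => nth [ffun=> false] s u) => u u' ne; exact: hs.
elim=> [_|k IH lt]; first by exists [::].
have [s [ss hs]] := IH (ltnW lt).
pose ball f := [set h : {ffun 'I_n -> bool} | 16 * hdist f h <= n]%SET%N.
have cb : (#|(\bigcup_(i < k) ball (nth [ffun=> false] s i))%SET| < 2 ^ n)%N.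
  apply: (@leq_ltn_trans (\sum_(i < k) #|ball (nth [ffun=> false] s i)|)%N).
    elim/big_rec2 : _ => [|i x y _ h]; first by rewrite cards0.
    by apply: leq_trans (leq_card_setU _ _) _; rewrite leq_add2l.
  rewrite -(@ltn_pmul2r (2 ^ b)) ?expn_gt0 // big_distrl /=.
  apply: (@leq_ltn_trans (\sum_(i < k) 2 ^ n)%N).
    by apply: leq_sum => i _; exact: hamming_ball_card.
  rewrite sum_nat_const card_ord mulnC ltn_pmul2l ?expn_gt0 //.
  exact: leq_trans lt hK.
have [h hh] : exists h, h \notin (\bigcup_(i < k) ball (nth [ffun=> false] s i))%SET.
  apply: contrapT => /forallNP hN; move: cb; rewrite ltnNge; apply/negP/negPn.
  rewrite -[X in (X <= _)%N](_ : #|{ffun 'I_n -> bool}| = _); last first.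
    by rewrite card_ffun card_bool card_ord.
  by apply: subset_leq_card; apply/fintype.subsetP => x _; apply/negPn/negP; exact: hN.
have far i : (i < k)%N -> (n < 16 * hdist (nth [ffun=> false] s i) h)%N.
  move=> hi; rewrite ltnNge; apply/negP => le.
  by move/negP: hh; apply; apply/finset.bigcupP; exists (Ordinal hi) => //; rewrite inE.
exists (rcons s h); rewrite size_rcons ss; split=> // i j.
rewrite !ltnS (leq_eqVlt i) (leq_eqVlt j) !nth_rcons ss => /orP[/eqP->|hi] /orP[/eqP->|hj].
- by rewrite eqxx.
- by rewrite hj ltnn eqxx hdistC => _; exact: far.
- by rewrite hi ltnn eqxx => _; exact: far.
- by rewrite hi hj; exact: hs.
Qed.

(** [T] is the integer part of the base-[B] logarithm of [W / (2 n D)]. As [W] is at least the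
    fourth power of [2 n D B], the prefactor and the rounding cost at most a quarter of [ln W]. *)
Lemma exists_scale_number (R : realType) (B D : nat) : (1 < B)%N -> (0 < D)%N ->
  exists C0 : nat, exists c : R, 0 < c /\ forall n W : nat, (0 < n)%N ->
    ((2 * n) ^ C0 <= W)%N ->
    exists T, (2 * n * D * B ^ T <= W)%N /\ c * ln W%:R <= T%:R.
Proof.
move=> hB hD; exists (4 + 4 * (D * B))%N.
have lnB : 0 < ln (B%:R : R) by rewrite ln_gt0 // ltr1n.
exists (3 / 4 / ln (B%:R : R)); split; first by rewrite divr_gt0.
move=> n W n0 hW; set N := (2 * n * D)%N.
have N0 : (0 < N)%N by rewrite !muln_gt0 n0 hD.
have hNB : ((N * B) ^ 4 <= W)%N.
  (* The part [4 D B] of the exponent absorbs the factor [(D B) ^ 4], because [D B < 2 ^ (D B)]. *)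
  apply: leq_trans hW; rewrite /N -mulnA expnMn expnD leq_mul2l; apply/orP; right.
  rewrite (mulnC 4%N) expnM leq_exp2r //; apply: ltnW.
  apply: leq_trans (ltn_expl (D * B) (ltnSn 1)) _.
  by rewrite leq_exp2r ?muln_gt0 ?hD ?(ltnW hB) //; lia.
have W0 : (0 < W)%N by apply: leq_trans hNB; rewrite expn_gt0 muln_gt0 N0 (ltnW hB).
have Q0 : (0 < W %/ N)%N.
  rewrite divn_gt0 //; apply: leq_trans hNB.
  apply: (@leq_trans (N * B)); first by rewrite leq_pmulr // ltnW.
  by rewrite -[X in (X <= _)%N]expn1; apply: leq_pexp2l => //; lia.
set T := trunc_log B (W %/ N); exists T.
have /andP[h1 h2] := trunc_log_bounds hB Q0.
split; first by rewrite mulnC -leq_divRL.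
rewrite ltn_divLR // in h2.
have lnN (k : nat) : (0 < k)%N -> (k%:R : R) \is Num.pos by move=> k0; rewrite posrE ltr0n.
have e1 : 4 * (ln N%:R + ln B%:R) <= ln W%:R :> R.
  rewrite -lnM ?lnN ?(ltnW hB) // -natrM mulr_natl -lnXn; last by rewrite ltr0n muln_gt0 N0 ltnW.
  by rewrite -natrX ler_ln ?ler_nat // lnN // expn_gt0 muln_gt0 N0 ltnW.
have e2 : ln W%:R <= (T.+1%:R * ln B%:R) + ln N%:R :> R.
  rewrite mulr_natl -lnXn ?ltr0n ?(ltnW hB) // -natrX -lnM ?lnN ?expn_gt0 ?(ltnW hB) //.
  by rewrite -natrM ler_ln ?ler_nat ?(ltnW h2) // lnN // muln_gt0 expn_gt0 N0 ltnW.
rewrite -natr1 mulrDl mul1r in e2.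
rewrite mulrAC ler_pdivrMr //; lra.
Qed.

(** * The two degenerate regimes *)

Lemma residualE (n T L : nat) (U : finType)
    (enc : 'I_T -> {ffun 'I_L -> U} -> 'rV[int]_n) (q : 'rV[int]_n)
    (M : {ffun 'I_T * 'I_L -> U}) (s : 'I_T) (i : 'I_n) :
  residual enc q M s 0 i = (enc s (slice M s) 0 i - q 0 i) +
    \sum_(s' < T | (s' < s)%N) enc s' (slice M s') 0 i.
Proof.
rewrite /residual !mxE summxE (bigD1 s) //= -!addrA; congr (_ + _).
rewrite addrC; congr (_ + _); apply: eq_bigl => s'.
by rewrite andbC -ltn_neqAle.
Qed.

Lemma sum_lower_scales (T B : nat) (s : 'I_T) : (0 < B)%N ->
  ((B.-1 * \sum_(s' < T | (s' < s)%N) B ^ s') < B ^ s)%N.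
Proof.
move=> hB; rewrite -(big_ord_widen _ (fun i => B ^ i)%N (ltnW (ltn_ord s))).
by rewrite -predn_exp prednK // expn_gt0 hB.
Qed.

Lemma le_powR (R : realType) (p x y : R) :
  0 <= p -> 0 <= x -> x <= y -> x `^ p <= y `^ p.
Proof.
move=> p0 x0 xy; apply: ge0_ler_powR => //; rewrite nnegrE //.
exact: le_trans xy.
Qed.

Lemma Lp_norm_ge0 (R : realType) (p : R) (n : nat) (x : 'rV[int]_n) :
  0 <= Lp_norm p x.
Proof. exact: powR_ge0. Qed.

Lemma Lp_norm_powR (R : realType) (p : R) (n : nat) (x : 'rV[int]_n) : p != 0 ->
  (Lp_norm p x) `^ p = \sum_(i < n) `|(x 0 i)%:~R| `^ p.
Proof.
move=> p0; rewrite /Lp_norm -powRrM mulVf // powRr1 //.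
by apply: sumr_ge0 => i _; exact: powR_ge0.
Qed.

(** Norms further apart than the factor [(1 + eps)^2] cannot share an output; every separation of
    symbols rests on this. *)
Lemma approximates_trans (R : realType) (eps x x' z : R) : 0 < eps ->
  approximates eps x z -> approximates eps x' z -> x <= (1 + eps) ^+ 2 * x'.
Proof.
move=> e0 /andP[h1 _] /andP[_ h2].
have h := le_trans h1 h2; rewrite ler_pdivrMr in h; last by lra.
by rewrite expr2; lra.
Qed.

(** The symbol [u] is the digit [8 ^ u] in base [B = 8 ^ K], and no query is subtracted. Lower
    scales at most double the leading term and the approximation loses less than a factor 4, so
    digits a factor 8 apart are distinguished. *)
Lemma one_coordinate_bound (R : realType) (a : nat) : (4 <= a)%N ->
  exists (C0 : nat) (c : R), 0 < c /\
  forall (p eps delta : R) (n W S : nat) (A : rand_alg R n),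
    1 <= p <= 2 -> 0 < eps < 1 -> 0 < delta < 1 / 2 -> (0 < n)%N ->
    ((2 * n) ^ C0 <= W)%N -> uses_bits A S -> estimates_Lp A p eps delta W ->
    c * ln W%:R <= S%:R.
Proof.
move=> ha; set K := (2 ^ (8 * a))%N.
have K0 : (0 < K)%N by rewrite expn_gt0.
set B := (8 ^ K)%N.
have hB : (1 < B)%N by rewrite -[1%N]/(8 ^ 0)%N ltn_exp2l.
have [C0 [c [c0 hT]]] := @exists_scale_number R B B hB (ltnW hB).
exists C0, (c / 4); split; first by rewrite divr_gt0.
move=> p eps delta [//|n] W S A /andP[p1 p2] /andP[e0 e1] /andP[d0 d1] _ hW hS hA.
have [T [hTW hcT]] := hT _ _ (ltn0Sn n) hW.
pose enc (_ : unit) (s : 'I_T) (m : {ffun 'I_1 -> 'I_K}) : 'rV[int]_n.+1 :=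
  (B ^ s * 8 ^ m ord0)%N%:Z *: delta_mx 0 ord0.
pose qry (_ : unit) (_ : 'I_T) (_ : 'I_1) (_ : unit) : 'rV[int]_n.+1 := 0.
pose Good (s : 'I_T) (_ : 'I_1) (u : 'I_K) (_ : unit) : set R :=
  [set x | (B ^ s * 8 ^ u)%N%:R <= x <= (2 * (B ^ s * 8 ^ u))%N%:R].
have enc8 (u : 'I_K) : (8 ^ u <= B.-1)%N.
  by rewrite -ltnS prednK ?(ltnW hB) // /B ltn_exp2l.
have hbound : (a * (T * 1) <= 4 * S)%N.
  apply: (@augmented_indexing_bound R n.+1 T 1 a B B W S A p eps delta unit 'I_K unit
    enc qry Good) => //.
  - by rewrite card_ord.
  - by rewrite card_unit.
  - move=> om s m i; rewrite !mxE; case: (_ && _); last by rewrite mulr0.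
    rewrite mulr1 absz_nat mulnC leq_mul2r; apply/orP; right.
    by apply: leq_trans (enc8 _) _; exact: leq_pred.
  - by move=> om s j g i; rewrite mxE.
  - by rewrite card_unit mul1r; lra.
  - have main s j (u u' : 'I_K) x x' z : (u < u')%N -> Good s j u tt x ->
        Good s j u' tt x' -> approximates eps x z -> approximates eps x' z -> False.
      move=> lt /andP[x1 x2] /andP[y1 y2] hx hx'.
      have h := approximates_trans e0 hx' hx.
      have b0 : 0 < (B ^ s * 8 ^ u)%N%:R :> R.
        by rewrite ltr0n muln_gt0 !expn_gt0 ?(ltnW hB).
      have le8 : 8 * (B ^ s * 8 ^ u)%N%:R <= (B ^ s * 8 ^ u')%N%:R :> R.
        rewrite -natrM ler_nat mulnCA leq_mul2l; apply/orP; right.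
        by rewrite -expnS leq_exp2l.
      have sq : (1 + eps) ^+ 2 < 4.
        by rewrite expr2; nra.
      rewrite natrM in x2.
      have x0 : 0 < x by exact: lt_le_trans x1.
      have : (1 + eps) ^+ 2 * x < 4 * x by rewrite ltr_pM2r.
      by lra.
    move=> s j u u' ne; exists tt => x x' gx gx' z hx hx'.
    have [lt|gt] : ((u < u') \/ (u' < u))%N.
      by apply/orP; rewrite -neq_ltn.
    - exact: main lt gx gx' hx hx'.
    - exact: main gt gx' gx hx' hx.
  - move=> M s j; rewrite [X in (8 * X)%N](_ : _ = 0%N) ?muln0 //.
    apply: eq_card0 => om; rewrite !inE; apply/negbF/asboolP => g.
    set r := residual _ _ _ _.
    pose v := (\sum_(s' < T | (s' <= s)%N) B ^ s' * 8 ^ M (s', ord0))%N.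
    have rE i : r 0 i = if i == ord0 then v%:Z else 0.
      rewrite /r /residual /qry subr0 summxE.
      have [->|ne] := eqVneq i ord0.
        rewrite /v (big_morph Posz PoszD (erefl 0)); apply: eq_bigr => s' _.
        by rewrite !mxE !eqxx mulr1 ffunE.
      by rewrite big1 // => s' _; rewrite !mxE (negPf ne) andbF mulr0.
    have -> : Lp_norm p r = v%:R.
      have p0 : p != 0 by lra.
      rewrite /Lp_norm (bigD1 ord0) //= big1 ?addr0.
        rewrite rE eqxx -powRrM mulfV // powRr1 // ger0_norm //.
      move=> i ne; rewrite rE (negPf ne) normr0 powR0 //.
    have vE : v = (B ^ s * 8 ^ M (s, ord0) +
        \sum_(s' < T | (s' < s)%N) B ^ s' * 8 ^ M (s', ord0))%N.
      rewrite /v (bigD1 s) //=; congr addn; apply: eq_bigl => s'.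
      by rewrite andbC -ltn_neqAle.
    have low : (\sum_(s' < T | (s' < s)%N) B ^ s' * 8 ^ M (s', ord0) <= B ^ s)%N.
      apply: leq_trans (ltnW (sum_lower_scales s (ltnW hB))).
      rewrite big_distrr /=; apply: leq_sum => s' _.
      by rewrite mulnC leq_mul2r enc8 orbT.
    rewrite /Good /= (ord1 j) !ler_nat vE leq_addr /= mul2n -addnn leq_add2l.
    by apply: leq_trans low _; rewrite leq_pmulr // expn_gt0.
rewrite muln1 in hbound.
have : T%:R <= S%:R :> R by rewrite ler_nat; nia.
have : 0 <= ln W%:R :> R.
  rewrite ln_ge0 // ler1n; apply: leq_trans hTW.
  by rewrite !muln_gt0 expn_gt0 (ltnW hB).
by move=> l0 hTS; nra.
Qed.

Lemma absz_sign_gap (b : nat) (l : int) (c d : bool) : c != d ->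
  (127 * absz l <= b)%N -> (b <= absz (b%:Z * (increment c - increment d) + l)%R)%N.
Proof. by case: c; case: d => //= _; rewrite /increment; lia. Qed.

(** Each scale carries one codeword and every codeword is tried as a query. The right one cancels
    the scale and leaves only lower scales; a wrong one leaves more than [n / 16] coordinates of
    size at least [B ^ s]. *)
Lemma large_eps_bound (R : realType) :
  exists (C0 : nat) (c : R), 0 < c /\
  forall (p eps delta : R) (n a W S : nat) (A : rand_alg R n),
    1 <= p <= 2 -> 0 < eps < 1 -> (0 < n)%N -> (4 <= a)%N -> (32 * a <= n)%N ->
    (2 ^ (8 * a))%:R * delta <= 1 / 2 ->
    ((2 * n) ^ C0 <= W)%N -> uses_bits A S -> estimates_Lp A p eps delta W ->
    c * (a%:R * ln W%:R) <= S%:R.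
Proof.
(* Base 128 keeps the lower scales below [B ^ s / 127] in each coordinate; then
   [(4 / 127)^p <= 4 / 127 < 1 / 16], where 4 bounds [(1 + eps)^2] and [p >= 1] is used. *)
have [B [hB BE]] : exists B, (1 < B)%N /\ (B = 128)%N by exists 128%N.
have [C0 [c [c0 hT]]] := @exists_scale_number R B 1 hB (ltnSn 0).
exists C0, (c / 4); split; first by rewrite divr_gt0.
move=> p eps delta n a W S A /andP[p1 p2] /andP[e0 e1] n0 ha han hd hW hS hA.
have [T [hTW hcT]] := hT _ _ n0 hW.
have h4 : (4 * (8 * a) <= n)%N by lia.
have [H hH] := gilbert_varshamov h4 (leqnn _).
set K := (2 ^ (8 * a))%N in H hH hd *.
pose enc (_ : unit) (s : 'I_T) (m : {ffun 'I_1 -> 'I_K}) : 'rV[int]_n :=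
  \row_i ((B ^ s)%N%:Z * increment (H (m ord0) i)).
pose qry (_ : unit) (s : 'I_T) (_ : 'I_1) (g : 'I_K) : 'rV[int]_n :=
  \row_i ((B ^ s)%N%:Z * increment (H g i)).
pose Good (s : 'I_T) (_ : 'I_1) (u g : 'I_K) : set R := [set x | 0 <= x /\
  if u == g then x `^ p <= n%:R * ((B ^ s)%N%:R / 127) `^ p
  else (n%:R / 16) * ((B ^ s)%N%:R) `^ p <= x `^ p].
have absi b : absz (increment b) = 1%N by case: b.
have p0 : 0 <= p by lra.
have pn0 : p != 0 by rewrite gt_eqF //; apply: lt_le_trans p1.
have nR : 0 < n%:R :> R by rewrite ltr0n.
have hbound : (a * (T * 1) <= 4 * S)%N.
  apply: (@augmented_indexing_bound R n T 1 a 1 B W S A p eps delta unit 'I_K 'I_K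
    enc qry Good) => //.
  - by rewrite card_ord.
  - by rewrite card_unit.
  - by move=> om s m i; rewrite !mxE abszM absi muln1 mul1n.
  - by move=> om s j g i; rewrite !mxE abszM absi muln1 mul1n.
  - by rewrite card_ord.
  - move=> s j u u' ne; exists u => x x' [x0]; rewrite eqxx => hx [x0'].
    rewrite eq_sym (negPf ne) => hx' z az az'.
    have b0 : 0 < (B ^ s)%N%:R :> R by rewrite ltr0n expn_gt0 ltnW.
    have h := approximates_trans e0 az' az.
    have {}h : x' <= 4 * x.
      apply: (le_trans h); apply: ler_wpM2r => //; rewrite expr2; nra.
    have h2 := le_powR p0 x0' h.
    rewrite powRM // in h2.
    have h3 : 4 `^ p * x `^ p <= 4 `^ p * (n%:R * ((B ^ s)%:R / 127) `^ p).
      by apply: ler_wpM2l => //; exact: powR_ge0.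
    have h4' : 4 `^ p * (n%:R * ((B ^ s)%:R / 127) `^ p) =
        n%:R * ((4 / 127) `^ p * (B ^ s)%N%:R `^ p) :> R.
      rewrite mulrCA -powRM ?divr_ge0 ?(ltW b0) // -powRM ?(ltW b0) //.
      by congr (_ * powR _ _); lra.
    have h5 : (4 / 127) `^ p <= 4 / 127 :> R.
      rewrite -[leRHS]powRr1; last by lra.
      by apply: ger_powR => //; lra.
    have bp : 0 < (B ^ s)%N%:R `^ p :> R by exact: powR_gt0.
    have h6 : n%:R * ((4 / 127) `^ p * (B ^ s)%N%:R `^ p) <=
        n%:R * (4 / 127 * (B ^ s)%N%:R `^ p) :> R.
      by rewrite ler_pM2l // ler_pM2r.
    have : 0 < n%:R * (B ^ s)%N%:R `^ p :> R by rewrite mulr_gt0.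
    nra.
  - move=> M s j; rewrite [X in (8 * X)%N](_ : _ = 0%N) ?muln0 //.
    apply: eq_card0 => om; rewrite finset.in_set; apply/negbF/asboolP => g.
    set r := residual _ _ _ _.
    split; first exact: Lp_norm_ge0.
    rewrite (Lp_norm_powR r pn0) (ord1 j).
    pose low i := \sum_(s' < T | (s' < s)%N) enc om s' (slice M s') 0 i.
    have rE i : r 0 i = (B ^ s)%N%:Z *
        (increment (H (M (s, ord0)) i) - increment (H g i)) + low i.
      by rewrite /r residualE !mxE ffunE mulrBr.
    have hlow i : (127 * absz (low i) <= B ^ s)%N.
      have := ltnW (sum_lower_scales s (ltnW hB)); rewrite {1}BE /=.
      apply: leq_trans; rewrite leq_mul2l /=; apply: leq_trans (absz_sum_le _ _) _.
      by apply: leq_sum => s' _; rewrite mxE abszM absi muln1.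
    case: eqP => [E|/eqP ne].
      rewrite -[n in n%:R * _]card_ord mulr_natl -sumr_const.
      apply: ler_sum => i _; apply: le_powR => //.
      rewrite rE E subrr mulr0 add0r -intr_norm -abszE ler_pdivlMr // mulrC -natrM.
      by rewrite ler_nat hlow.
    have far := hH _ _ ne.
    rewrite (bigID (fun i => H (M (s, ord0)) i != H g i)) /=.
    apply: (@le_trans _ _ (\sum_(i < n | H (M (s, ord0)) i != H g i) (B ^ s)%N%:R `^ p)).
      rewrite sumr_const -[leRHS]mulr_natl; apply: ler_wpM2r; first exact: powR_ge0.
      rewrite ler_pdivrMr // -natrM ler_nat mulnC; apply: ltnW.
      move: far; rewrite /hdist; congr (_ < 16 * _)%N.
      by apply: eq_card => i; rewrite finset.in_set.
    rewrite -[leLHS]addr0; apply: lerD; last first.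
      by apply: sumr_ge0 => i _; exact: powR_ge0.
    apply: ler_sum => i hi; apply: le_powR => //.
    rewrite -intr_norm -abszE ler_nat rE.
    exact: absz_sign_gap hi (hlow i).
rewrite muln1 in hbound.
have : a%:R * T%:R <= 4 * S%:R :> R by rewrite -!natrM ler_nat.
have a0 : 0 <= a%:R :> R by [].
move=> haT; have := ler_wpM2l a0 hcT; lra.
Qed.

(** * Concentration and moments of random votes *)

(** Inverting [1 - x <= expR (- x)], it is enough that [(1 + x + 2 x^2) (1 - x) = 1 + x^2 (1 - 2 x)]
    is at least 1. *)
Lemma expR_le_quadratic (R : realType) (x : R) :
  `|x| <= 1 / 2 -> expR x <= 1 + x + 2 * x ^+ 2.
Proof.
rewrite ler_norml => /andP[h1 h2].
have h : 1 - x <= expR (- x) by exact: expR_ge1Dx.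
have e0 : 0 < expR x by exact: expR_gt0.
have : expR x * (1 - x) <= 1.
  by rewrite -[leRHS](expRxMexpNx_1 x) ler_pM2l.
have : 1 <= (1 + x + 2 * x ^+ 2) * (1 - x).
  have : 0 <= x ^+ 2 * (1 - 2 * x) by rewrite mulr_ge0 ?sqr_ge0 //; lra.
  by lra.
move=> h3 h4; have : expR x * (1 - x) <= (1 + x + 2 * x ^+ 2) * (1 - x) by lra.
by rewrite ler_pM2r //; lra.
Qed.

(** Chernoff's method for the counting measure on [{ffun I -> C}]: the exponential moment factors
    over [I], and each factor has no linear term because [f i] has mean zero. *)
Lemma hoeffding_count (R : realType) (I C : finType) (f : I -> C -> R) (lam : R) :
  0 < lam <= 18 -> (forall i, \sum_c f i c = 0) -> (forall i c, `|f i c| <= 9) ->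
  #|[set w : {ffun I -> C} | lam * #|I|%:R <= \sum_i f i (w i)]%SET|%:R <=
    #|{ffun I -> C}|%:R * expR (- (lam ^+ 2 / 648) * #|I|%:R).
Proof.
(* This [t] minimizes the exponent [162 t^2 - lam t], with value [- lam^2 / 648]; [lam <= 18] keeps
   [9 t] within 1/2. *)
move=> /andP[l0 l18] f0 f9; set n := #|I|%:R; pose t := lam / 324.
have t0 : 0 < t by rewrite /t; lra.
have tl : t * 9 <= 1 / 2 by rewrite /t; lra.
have mgf i : \sum_c expR (t * f i c) <= #|C|%:R * expR (162 * t ^+ 2).
  apply: (@le_trans _ _ (\sum_c (1 + t * f i c + 162 * t ^+ 2))).
    apply: ler_sum => c _; have h9 := f9 i c.
    have tf : `|t * f i c| <= 1 / 2.
      rewrite normrM gtr0_norm //; apply: le_trans tl.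
      by rewrite ler_pM2l.
    apply: (le_trans (expR_le_quadratic tf)); rewrite lerD2l exprMn.
    have : f i c ^+ 2 <= 81.
      rewrite -real_normK ?num_real // (_ : 81 = 9 ^+ 2); last by rewrite -natrX.
      by rewrite ler_sqr ?nnegrE.
    have : 0 <= t ^+ 2 by exact: sqr_ge0.
    by nra.
  rewrite !big_split /= -mulr_sumr f0 mulr0 addr0 !sumr_const -mulrnDl -[leLHS]mulr_natl.
  by apply: ler_wpM2l => //; exact: expR_ge1Dx.
have total : \sum_(w : {ffun I -> C}) expR (t * \sum_i f i (w i)) <=
    #|{ffun I -> C}|%:R * expR (162 * t ^+ 2 * n).
  rewrite (eq_bigr (fun w : {ffun I -> C} => \prod_i expR (t * f i (w i)))); last first.
    by move=> w _; rewrite mulr_sumr expR_sum.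
  rewrite -(bigA_distr_bigA (fun i c => expR (t * f i c))) /=.
  apply: (@le_trans _ _ (\prod_(i : I) (#|C|%:R * expR (162 * t ^+ 2)))).
    apply: ler_prod => i _; rewrite mgf andbT.
    by apply: sumr_ge0 => c _; exact: expR_ge0.
  by rewrite prodr_const exprMn card_ffun natrX -expRM_natr.
have markov : #|[set w : {ffun I -> C} | lam * n <= \sum_i f i (w i)]%SET|%:R *
    expR (t * (lam * n)) <= \sum_(w : {ffun I -> C}) expR (t * \sum_i f i (w i)).
  rewrite mulr_natl -sumr_const big_mkcond /=; apply: ler_sum => w _.
  rewrite finset.in_set; case: ifP => [h|_]; last exact: expR_ge0.
  by rewrite ler_expR ler_pM2l.
have := le_trans markov total.
rewrite -ler_pdivlMr ?expR_gt0 // -expRN -[_ * expR _ * expR _]mulrA -expRD.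
by congr (_ <= _ * expR _); rewrite /t; field.
Qed.

Definition xorf (P : finType) (d c : {ffun P -> bool}) : {ffun P -> bool} :=
  [ffun x => d x (+) c x].

Lemma xorfK (P : finType) (d : {ffun P -> bool}) : involutive (xorf d).
Proof. by move=> c; apply/ffunP => x; rewrite !ffunE addKb. Qed.

(** Translation invariance of uniform coins: it allows flipping chosen coins, and absorbing fixed
    codewords into the random signs. *)
Lemma sum_xorf (R : realType) (P : finType) (d : {ffun P -> bool})
    (F : {ffun P -> bool} -> R) : \sum_c F (xorf d c) = \sum_c F c.
Proof.
rewrite [RHS](reindex_inj (inv_inj (xorfK d))); exact: eq_bigr.
Qed.

Definition sigma (R : realType) (b : bool) : R := (increment b)%:~R.

Lemma sigmaN (R : realType) (b : bool) : sigma R (~~ b) = - sigma R b.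
Proof. by case: b; rewrite /sigma /increment ?opprK //= mulrNz ?opprK. Qed.

Lemma sqr_sigma (R : realType) (b : bool) : sigma R b ^+ 2 = 1.
Proof. by case: b; rewrite /sigma /increment /= ?mulrNz ?sqrrN expr1n. Qed.

Definition vote (R : realType) (T L : nat) (c : {ffun 'I_T * 'I_L -> bool})
    (s : 'I_T) : R := \sum_(j < L) sigma R (c (s, j)).

(* Moments of the partial votes, by flipping the coins one at a time. *)
Lemma vote_moments (R : realType) (T L : nat) (s : 'I_T) :
  (\sum_(c : {ffun 'I_T * 'I_L -> bool}) vote R c s ^+ 2 = #|{ffun 'I_T * 'I_L -> bool}|%:R * L%:R) /\
  (\sum_(c : {ffun 'I_T * 'I_L -> bool}) vote R c s ^+ 4 <= #|{ffun 'I_T * 'I_L -> bool}|%:R * (3 * L%:R ^+ 2)).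
Proof.
pose C := {ffun 'I_T * 'I_L -> bool}.
pose Y (l : nat) (c : C) := \sum_(j < L | (j < l)%N) sigma R (c (s, j)).
suff H l : (l <= L)%N -> (\sum_c Y l c ^+ 2 = #|{: C}|%:R * l%:R) /\
    (\sum_c Y l c ^+ 4 <= #|{: C}|%:R * (3 * l%:R ^+ 2)).
  have E (c : C) : Y L c = vote R c s by apply: eq_bigl => j; rewrite ltn_ord.
  have [h2 h4] := H L (leqnn L); split.
    by rewrite -h2; apply: eq_bigr => c _; rewrite E.
  by apply: le_trans h4; apply: ler_sum => c _; rewrite E.
elim: l => [_|l IH lt].
  have Y0 k : \sum_c Y 0%N c ^+ k.+1 = 0.
    by apply: big1 => c _; rewrite /Y big_pred0 ?expr0n.
  by rewrite !Y0 mulr0; split=> //; rewrite !mulr_ge0.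
have [IH2 IH4] := IH (ltnW lt).
pose l' := Ordinal lt.
have YS c : Y l.+1 c = Y l c + sigma R (c (s, l')).
  rewrite /Y (bigD1 l') ?ltnSn //= addrC; congr (_ + _); apply: eq_bigl => j.
  by rewrite ltnS andbC -ltn_neqAle.
pose d : C := [ffun x => x == (s, l')].
have Yd c : Y l (xorf d c) = Y l c.
  apply: eq_bigr => j hj; rewrite !ffunE; case: eqP => // -[E].
  by move: hj; rewrite E ltnn.
have sd c : sigma R (xorf d c (s, l')) = - sigma R (c (s, l')).
  by rewrite !ffunE eqxx -sigmaN.
have fold (k : nat) : 2 * \sum_c Y l.+1 c ^+ k =
    \sum_c ((Y l c + sigma R (c (s, l'))) ^+ k + (Y l c - sigma R (c (s, l'))) ^+ k).
  rewrite big_split /= mulr_natl mulr2n; congr (_ + _).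
    by apply: eq_bigr => c _; rewrite YS.
  by rewrite -(sum_xorf d); apply: eq_bigr => c _; rewrite YS Yd sd.
have cN : #|{: C}|%:R = \sum_(c : C) 1 :> R by rewrite sumr_const.
split.
  have := fold 2%N; rewrite [X in _ = X -> _](eq_bigr (fun c => 2 * (Y l c ^+ 2 + 1))); last first.
    move=> c _; have := sqr_sigma R (c (s, l')); set x := sigma _ _; set y := Y _ _ => h.
    have -> : (y + x) ^+ 2 + (y - x) ^+ 2 = 2 * (y ^+ 2 + x ^+ 2) by ring.
    by rewrite h.
  by rewrite -mulr_sumr big_split /= IH2 -cN -natr1; lra.
have := fold 4%N; rewrite [X in _ = X -> _](eq_bigr (fun c => 2 * (Y l c ^+ 4 + 6 * Y l c ^+ 2 + 1))); last first.
  move=> c _; have := sqr_sigma R (c (s, l')); set x := sigma _ _; set y := Y _ _ => h.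
  have h4 : x ^+ 4 = 1 by rewrite (exprM x 2 2) h expr1n.
  have -> : (y + x) ^+ 4 + (y - x) ^+ 4 = 2 * (y ^+ 4 + 6 * y ^+ 2 * x ^+ 2 + x ^+ 4) by ring.
  by rewrite h h4 mulr1.
rewrite -mulr_sumr !big_split /= -mulr_sumr IH2 -cN -natr1.
have : 0 <= #|{: C}|%:R :> R by [].
move=> c0 h.
(* The induction closes because [3 l^2 + 6 l + 1 <= 3 (l + 1)^2]. *)
have : \sum_c Y l.+1 c ^+ 4 = \sum_c Y l c ^+ 4 + 6 * (#|{: C}|%:R * l%:R) + #|{: C}|%:R by lra.
move=> ->; nra.
Qed.

(** With [b = sqrt L] and [t = |y| / (3 b)], the inequality [t - t^3 <= 1] bounds [|y|] below by
    [y^2 / (3 b) - y^4 / (27 b^3)]. The two moments turn its average into at least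
    [b / 3 - b / 9]. *)
Lemma sum_abs_vote (R : realType) (T L : nat) (s : 'I_T) : (0 < L)%N ->
  #|{ffun 'I_T * 'I_L -> bool}|%:R * (2 / 9 * Num.sqrt L%:R) <=
    \sum_(c : {ffun 'I_T * 'I_L -> bool}) `|vote R c s|.
Proof.
move=> L0; set b := Num.sqrt _.
have b0 : 0 < b by rewrite sqrtr_gt0 ltr0n.
have b2 : b ^+ 2 = L%:R by rewrite sqr_sqrtr.
have [m2 m4] := vote_moments R L s.
have pw (y : R) : y ^+ 2 / (3 * b) - y ^+ 4 / (27 * b ^+ 3) <= `|y|.
  have -> : y ^+ 2 = `|y| ^+ 2 by rewrite real_normK ?num_real.
  have -> : y ^+ 4 = `|y| ^+ 4.
    by rewrite !(exprM _ 2 2) real_normK ?num_real.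
  set w := `|y|; have w0 : 0 <= w by exact: normr_ge0.
  have -> : w ^+ 2 / (3 * b) - w ^+ 4 / (27 * b ^+ 3) =
      w * (w / (3 * b) - (w / (3 * b)) ^+ 3) by field; rewrite gt_eqF.
  rewrite -[leRHS]mulr1; apply: ler_wpM2l => //.
  have : 0 <= w / (3 * b) by rewrite divr_ge0 // mulr_ge0 // ltW.
  set t := w / _ => t0; rewrite !exprS expr0 mulr1.
  by have [t1|t1] := leP t 1; nra.
apply: (@le_trans _ _ (\sum_(c : {ffun 'I_T * 'I_L -> bool})
    (vote R c s ^+ 2 / (3 * b) - vote R c s ^+ 4 / (27 * b ^+ 3)))); last first.
  by apply: ler_sum => c _; exact: pw.
rewrite big_split /= sumrN -!mulr_suml m2.
apply: (@le_trans _ _ (#|{ffun 'I_T * 'I_L -> bool}|%:R * L%:R / (3 * b) -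
   #|{ffun 'I_T * 'I_L -> bool}|%:R * (3 * L%:R ^+ 2) / (27 * b ^+ 3))); last first.
  rewrite lerD2l lerN2; apply: ler_wpM2r => //.
  by rewrite invr_ge0 mulr_ge0 // exprn_ge0 // ltW.
rewrite -b2 le_eqVlt; apply/orP; left; apply/eqP.
by field; rewrite gt_eqF.
Qed.

(** The superposed symbol at one coordinate; it is 0 when the vote is tied. *)
Definition digit (R : realType) (T L : nat) (c : {ffun 'I_T * 'I_L -> bool})
    (s : 'I_T) : R := Num.sg (vote R c s).

Definition noise (R : realType) (T L : nat) (c : {ffun 'I_T * 'I_L -> bool})
    (s : 'I_T) : R :=
  \sum_(s' < T | (s' < s)%N) (4 ^ s')%N%:R / (4 ^ s)%N%:R * digit R c s'.

(** The contribution of one coordinate to the p-th power of the norm, in units of [4 ^ s]. The coins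
    [c] already contain the codeword bits, and [e] tells whether the query bit differs from the
    queried codeword bit. *)
Definition cost (R : realType) (p : R) (T L : nat) (s : 'I_T) (j : 'I_L) (e : bool)
    (c : {ffun 'I_T * 'I_L -> bool}) : R :=
  `|digit R c s - sigma R (e (+) c (s, j)) + noise R c s| `^ p.

Definition mean_cost (R : realType) (p : R) (T L : nat) (s : 'I_T) (j : 'I_L)
    (e : bool) : R :=
  (\sum_c cost p s j e c) / #|{ffun 'I_T * 'I_L -> bool}|%:R.

Lemma normr_digit (R : realType) (T L : nat) (c : {ffun 'I_T * 'I_L -> bool})
    (s : 'I_T) : `|digit R c s| <= 1.
Proof. by rewrite /digit normr_sg; case: (_ != 0). Qed.

Lemma normr_noise (R : realType) (T L : nat) (c : {ffun 'I_T * 'I_L -> bool})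
    (s : 'I_T) : `|noise R c s| <= 1 / 3.
Proof.
apply: le_trans (ler_norm_sum _ _ _) _.
have b0 : 0 < (4 ^ s)%N%:R :> R by rewrite ltr0n expn_gt0.
apply: (@le_trans _ _ (\sum_(s' < T | (s' < s)%N) (4 ^ s')%N%:R / (4 ^ s)%N%:R)).
  apply: ler_sum => s' _; rewrite normrM -[leRHS]mulr1.
  rewrite ger0_norm ?divr_ge0 //; apply: ler_wpM2l; first by rewrite divr_ge0.
  exact: normr_digit.
rewrite -mulr_suml -natr_sum ler_pdivrMr //.
have : (3 * \sum_(s' < T | (s' < s)%N) 4 ^ s')%N%:R <= (4 ^ s)%N%:R :> R.
  by rewrite ler_nat; exact: (ltnW (sum_lower_scales s _)).
by rewrite natrM; lra.
Qed.

Lemma normr_sigma (R : realType) (b : bool) : `|sigma R b| = 1.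
Proof. by case: b; rewrite /sigma /increment /= ?mulrNz ?normrN normr1. Qed.

Lemma cost_ge0 (R : realType) (p : R) (T L : nat) (s : 'I_T) (j : 'I_L) (e : bool)
    (c : {ffun 'I_T * 'I_L -> bool}) : 0 <= cost p s j e c.
Proof. exact: powR_ge0. Qed.

Lemma cost_le9 (R : realType) (p : R) (T L : nat) (s : 'I_T) (j : 'I_L) (e : bool)
    (c : {ffun 'I_T * 'I_L -> bool}) : 1 <= p <= 2 -> cost p s j e c <= 9.
Proof.
move=> /andP[p1 p2].
have h3 : `|digit R c s - sigma R (e (+) c (s, j)) + noise R c s| <= 3.
  have h1 := normr_digit R c s; have h2 := normr_noise R c s.
  have h4 := normr_sigma R (e (+) c (s, j)).
  apply: le_trans (ler_normD _ _) _.
  have := ler_normB (digit R c s) (sigma R (e (+) c (s, j))); lra.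
apply: (@le_trans _ _ (3 `^ p)); first by apply: le_powR => //; lra.
apply: (@le_trans _ _ (3 `^ 2%:R)); first by apply: ler_powR => //; lra.
by rewrite powR_mulrn // -natrX.
Qed.

Lemma card_coins_gt0 (R : realType) (T L : nat) :
  0 < #|{ffun 'I_T * 'I_L -> bool}|%:R :> R.
Proof. by rewrite ltr0n card_ffun expn_gt0 card_bool. Qed.

Lemma mean_cost_bounds (R : realType) (p : R) (T L : nat) (s : 'I_T) (j : 'I_L)
    (e : bool) : 1 <= p <= 2 -> 0 <= mean_cost p s j e <= 9.
Proof.
move=> hp; rewrite /mean_cost divr_ge0 /=; last 2 first.
- by apply: sumr_ge0 => c _; exact: cost_ge0.
- by [].
rewrite ler_pdivrMr ?card_coins_gt0 // mulr_natr -sumr_const.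
by apply: ler_sum => c _; exact: cost_le9.
Qed.

(* Averaging over the flip of the whole scale [s] leaves only the correlation of
   a coin with the sign of the vote, weighted by a function of the noise. *)
Lemma sum_cost_gap (R : realType) (p : R) (T L : nat) (s : 'I_T) (j : 'I_L) :
  2 * \sum_c (cost p s j true c - cost p s j false c) =
  \sum_(c : {ffun 'I_T * 'I_L -> bool}) digit R c s * sigma R (c (s, j)) *
    (`|2 + noise R c s| `^ p + `|2 - noise R c s| `^ p - 2 * `|noise R c s| `^ p).
Proof.
pose d : {ffun 'I_T * 'I_L -> bool} := [ffun x => x.1 == s].
have dE c : digit R (xorf d c) s = - digit R c s.
  rewrite /digit -sgrN /vote -sumrN; congr Num.sg; apply: eq_bigr => k _.
  by rewrite !ffunE /= eqxx -sigmaN.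
have nE c : noise R (xorf d c) s = noise R c s.
  apply: eq_bigr => s' lt; congr (_ * _); congr Num.sg; apply: eq_bigr => k _.
  by rewrite !ffunE /=; case: eqP => // E; move: lt; rewrite E ltnn.
rewrite mulr_natl mulr2n -{2}(sum_xorf d) -big_split /=; apply: eq_bigr => c _.
rewrite /cost dE nE !ffunE /= eqxx /=.
have -> : sigma R (true (+) (true (+) c (s, j))) = sigma R (c (s, j)) by rewrite addKb.
rewrite /= !sigmaN; set z := noise _ _ _; set x := sigma _ _.
have x1 : x = 1 \/ x = -1.
  by rewrite /x /sigma /increment; case: (c _) => /=; [left|right].
have d3 : [\/ digit R c s = 1, digit R c s = -1 | digit R c s = 0].
  rewrite /digit; case: (ltgtP (vote R c s) 0) => h.
  - by constructor 2; rewrite ltr0_sg.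
  - by constructor 1; rewrite gtr0_sg.
  - by constructor 3; rewrite h sgr0.
pose f (u : R) := `|u + z| `^ p.
have f2 : f (-2) = `|2 - z| `^ p by rewrite /f -normrN opprD opprK.
have f0 : f 0 = `|z| `^ p by rewrite /f add0r.
rewrite -f0 -f2 -/(f 2) -!/(f _).
have fE u v : u = v -> f u = f v by move->.
case: d3 => ->; case: x1 => ->; rewrite ?mulr1 ?mulrN1 ?mul1r ?mulN1r ?mul0r ?opprK.
- rewrite (fE (1 + 1) 2) ?(fE (1 - 1) 0) ?(fE (- 1 - 1) (-2)) ?(fE (- 1 + 1) 0); lra.
- rewrite (fE (1 - 1) 0) ?(fE (1 + 1) 2) ?(fE (- 1 + 1) 0) ?(fE (- 1 - 1) (-2)); lra.
- rewrite (fE (- 1 + 1) 0) ?(fE (- 1 - 1) (-2)) ?(fE (1 - 1) 0) ?(fE (1 + 1) 2); lra.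
- rewrite (fE (- 1 - 1) (-2)) ?(fE (- 1 + 1) 0) ?(fE (1 + 1) 2) ?(fE (1 - 1) 0); lra.
- rewrite oppr0; lra.
- rewrite oppr0; lra.
Qed.

(** Exchanging two positions of a scale shows that all of them have the same correlation with the
    digit. The correlations add up to the mean of [|vote|], of order [sqrt L], so each is of order
    [1 / sqrt L]. *)
Lemma mean_cost_gap (R : realType) (p : R) (T L : nat) (s : 'I_T) (j : 'I_L) :
  1 <= p <= 2 ->
  2 / 9 / Num.sqrt L%:R <= mean_cost p s j true - mean_cost p s j false :> R.
Proof.
move=> /andP[p1 p2].
have L0 : (0 < L)%N by apply: leq_ltn_trans (ltn_ord j).
pose Psi (c : {ffun 'I_T * 'I_L -> bool}) : R :=
  `|2 + noise R c s| `^ p + `|2 - noise R c s| `^ p - 2 * `|noise R c s| `^ p.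
(* As the noise is at most 1/3, [Psi] is at least [5/3 + 5/3 - 2/3]. *)
have hPsi c : 2 <= Psi c.
  have := normr_noise R c s; rewrite ler_norml => /andP[z1 z2].
  have low (y : R) : 5 / 3 <= y -> 5 / 3 <= `|y| `^ p.
    move=> hy; have y1 : 1 <= `|y| by rewrite ger0_norm; lra.
    rewrite -[leLHS]powRr1; last by lra.
    apply: (@le_trans _ _ (`|y| `^ 1)); last exact: ler_powR.
    by apply: le_powR => //; try lra; rewrite ger0_norm; lra.
  have a1 := low (2 + noise R c s) ltac:(lra).
  have a2 := low (2 - noise R c s) ltac:(lra).
  have a3 : `|noise R c s| `^ p <= 1 / 3.
    apply: (@le_trans _ _ ((1 / 3) `^ p)).
      by apply: le_powR => //; [lra|exact: normr_noise].
    rewrite -[leRHS]powRr1; last by lra.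
    by apply: ger_powR => //; lra.
  by rewrite /Psi; lra.
pose F (k : 'I_L) := \sum_c digit R c s * sigma R (c (s, k)) * Psi c.
have sym (k : 'I_L) : F k = F j.
  pose tau (x : 'I_T * 'I_L) := (x.1, tperm j k x.2).
  have tauK : involutive tau by case=> a b; rewrite /tau /= tpermK.
  pose act (c : {ffun 'I_T * 'I_L -> bool}) : {ffun 'I_T * 'I_L -> bool} :=
    [ffun x => c (tau x)].
  have actK : involutive act by move=> c; apply/ffunP => x; rewrite !ffunE tauK.
  have vE c s' : vote R (act c) s' = vote R c s'.
    rewrite /vote [RHS](reindex_inj (@perm_inj _ (tperm j k))).
    by apply: eq_bigr => b _; rewrite ffunE.
  have nE c : noise R (act c) s = noise R c s.
    by apply: eq_bigr => s' _; rewrite /digit vE.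
  rewrite /F (reindex_inj (inv_inj actK)); apply: eq_bigr => c _.
  by rewrite /Psi nE /digit vE ffunE /tau /= tpermR.
have tot : L%:R * F j = \sum_c `|vote R c s| * Psi c.
  rewrite -[L in L%:R]card_ord mulr_natl -sumr_const.
  rewrite (eq_bigr F) => [|k _]; last by rewrite sym.
  rewrite exchange_big /=; apply: eq_bigr => c _.
  rewrite -mulr_suml -mulr_sumr; congr (_ * _).
  by rewrite /digit -/(vote R c s) -normrEsg.
have low : 2 * (#|{ffun 'I_T * 'I_L -> bool}|%:R * (2 / 9 * Num.sqrt L%:R)) <= L%:R * F j.
  rewrite tot; apply: (@le_trans _ _ (\sum_c `|vote R c s| * 2)).
    by rewrite -mulr_suml mulrC ler_pM2r //; exact: sum_abs_vote.
  by apply: ler_sum => c _; apply: ler_wpM2l.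
have card0 := card_coins_gt0 R T L.
have LR : 0 < L%:R :> R by rewrite ltr0n.
have b0 : 0 < Num.sqrt L%:R :> R by rewrite sqrtr_gt0.
have b2 : Num.sqrt L%:R ^+ 2 = L%:R :> R by rewrite sqr_sqrtr.
have gapE : 2 * \sum_c (cost p s j true c - cost p s j false c) = F j by exact: sum_cost_gap.
rewrite /mean_cost -mulrBl -sumrB ler_pdivlMr // mulrAC ler_pdivrMr //.
move: low gapE; set X := \sum_c _; set b := Num.sqrt _ in b0 b2 *.
set N := #|_|%:R => low gapE.
rewrite -subr_ge0 -(pmulr_rge0 _ b0).
by rewrite -b2 -gapE expr2 in low; lra.
Qed.

(** * Superposed codewords *)

(** The normalized p-th power of the norm concentrates around [mu], which is affine in the Hamming
    distance from query to codeword with slope [mean_cost p s j true - mean_cost p s j false]. A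
    distance gap of [theta n] must beat two deviations [lam n] and the approximation error
    [150 eps n]. *)
Lemma superposition_bound (R : realType) (p eps delta lam theta : R)
    (n a L T W S : nat) (A : rand_alg R n) (U Ga : finType)
    (H : U -> {ffun 'I_n -> bool}) (Gm : Ga -> {ffun 'I_n -> bool}) :
  1 <= p <= 2 -> 0 < eps < 1 -> (0 < n)%N -> (4 <= a)%N -> #|U| = (2 ^ (8 * a))%N ->
  #|Ga|%:R * delta <= 1 / 2 -> 0 < lam <= 1 ->
  16 * #|Ga|%:R * expR (- (lam ^+ 2 / 648) * n%:R) <= 1 ->
  (forall u u', u != u' -> exists g,
     theta * n%:R <= `|(hdist (Gm g) (H u))%:R - (hdist (Gm g) (H u'))%:R|) ->
  2 * lam + 150 * eps < theta * (2 / 9 / Num.sqrt L%:R) ->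
  (2 * n * 1 * 4 ^ T <= W)%N -> uses_bits A S -> estimates_Lp A p eps delta W ->
  (a * (T * L) <= 4 * S)%N.
Proof.
move=> hp /andP[e0 e1] n0 ha cU hGa /andP[l0 l1] htail hsep hgap hW hS hA.
have /andP[p1 p2] := hp.
have pge0 : 0 <= p by lra.
have pn0 : p != 0 by rewrite gt_eqF //; apply: lt_le_trans p1.
have nR : 0 < n%:R :> R by rewrite ltr0n.
pose C := {ffun 'I_T * 'I_L -> bool}.
pose Om := {ffun 'I_n -> C}.
pose enc (om : Om) (s : 'I_T) (m : {ffun 'I_L -> U}) : 'rV[int]_n :=
  \row_i ((4 ^ s)%N%:Z * Num.sg (\sum_j increment (H (m j) i (+) om i (s, j)))).
pose qry (om : Om) (s : 'I_T) (j : 'I_L) (g : Ga) : 'rV[int]_n :=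
  \row_i ((4 ^ s)%N%:Z * increment (Gm g i (+) om i (s, j))).
pose mu (s : 'I_T) (j : 'I_L) (u : U) (g : Ga) : R := \sum_i mean_cost p s j (Gm g i (+) H u i).
pose Good (s : 'I_T) (j : 'I_L) (u : U) (g : Ga) : set R := [set x | 0 <= x /\
  `|x `^ p / (4 ^ s)%N%:R `^ p - mu s j u g| <= lam * n%:R].
have b0 (s : 'I_T) : 0 < (4 ^ s)%N%:R :> R by rewrite ltr0n expn_gt0.
have bp (s : 'I_T) : 0 < (4 ^ s)%N%:R `^ p :> R by exact: powR_gt0.
have muE s j u g : mu s j u g = n%:R * mean_cost p s j false +
    (hdist (Gm g) (H u))%:R * (mean_cost p s j true - mean_cost p s j false).
  rewrite /mu (eq_bigr (fun i => mean_cost p s j false +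
    (Gm g i != H u i)%:R * (mean_cost p s j true - mean_cost p s j false))).
    rewrite big_split /= sumr_const card_ord mulr_natl; congr (_ + _).
    rewrite -mulr_suml; congr (_ * _); rewrite -natr_sum /hdist -sum1_card.
    congr (_%:R); rewrite [RHS]big_mkcond /=; apply: eq_bigr => i _.
    by rewrite finset.in_set; case: (_ != _).
  by move=> i _; case: (Gm g i); case: (H u i); rewrite /= ?mul0r ?addr0 ?mul1r ?subrKC.
have mu_le s j u g : mu s j u g <= 9 * n%:R.
  rewrite mulr_natr -[n in _ *+ n]card_ord -sumr_const; apply: ler_sum => i _.
  by have /andP[] := @mean_cost_bounds R p T L s j (Gm g i (+) H u i) hp.
apply: (@augmented_indexing_bound R n T L a 1 4 W S A p eps delta Om U Ga
    enc qry Good) => //.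
- by apply/card_gt0P; exists [ffun => [ffun => false]].
- move=> om s m i; rewrite mxE abszM mul1n absz_nat -[leqRHS]muln1 leq_mul2l.
  by apply/orP; right; case: sgrP.
- move=> om s j g i; rewrite mxE abszM mul1n absz_nat -[leqRHS]muln1 leq_mul2l.
  by apply/orP; right; case: (_ (+) _).
(* The constant is [15 * 10]: [(1 + eps)^4 <= 1 + 15 eps], and the normalized power is at most
   [9 n + lam n <= 10 n]. *)
- have half s j u u' g x x' z : Good s j u g x -> Good s j u' g x' ->
      approximates eps x z -> approximates eps x' z ->
      x `^ p / (4 ^ s)%N%:R `^ p - x' `^ p / (4 ^ s)%N%:R `^ p <= 150 * eps * n%:R.
    move=> [x0 gx] [x0' gx'] az az'.
    have h := approximates_trans e0 az az'.
    have e2 : 0 <= (1 + eps) ^+ 2 by exact: sqr_ge0.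
    have {}h := le_powR pge0 x0 h; rewrite powRM // in h.
    have h15 : ((1 + eps) ^+ 2) `^ p <= 1 + 15 * eps.
      apply: (@le_trans _ _ (((1 + eps) ^+ 2) `^ 2%:R)).
        by apply: ler_powR => //; rewrite expr2; nra.
      rewrite powR_mulrn // -exprM /=.
      have -> : (1 + eps) ^+ (2 * 2) = 1 + eps * (4 + 6 * eps + 4 * eps ^+ 2 + eps ^+ 3) by ring.
      rewrite lerD2l mulrC ler_pM2r //.
      have : eps ^+ 2 <= 1 by rewrite expr_le1 // ltW.
      have : eps ^+ 3 <= 1 by rewrite expr_le1 // ltW.
      by lra.
    have xp0 : 0 <= x' `^ p / (4 ^ s)%N%:R `^ p by rewrite divr_ge0 // powR_ge0.
    have x10 : x' `^ p / (4 ^ s)%N%:R `^ p <= 10 * n%:R.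
      have := mu_le s j u' g; move: gx'; rewrite ler_norml => /andP[_ g2] hm.
      have : lam * n%:R <= 1 * n%:R by rewrite ler_pM2r.
      by lra.
    have : x `^ p / (4 ^ s)%N%:R `^ p <= (1 + 15 * eps) * (x' `^ p / (4 ^ s)%N%:R `^ p).
      rewrite ler_pdivrMr // mulrA divfK ?gt_eqF //; apply: (le_trans h).
      by apply: ler_wpM2r => //; exact: powR_ge0.
    have := ler_wpM2l (ltW e0) x10.
    by lra.
  move=> s j u u' ne; have [g hg] := hsep u u' ne; exists g => x x' gx gx' z az az'.
  have h1 := half _ _ _ _ _ _ _ _ gx gx' az az'.
  have h2 := half _ _ _ _ _ _ _ _ gx' gx az' az.
  have [_] := gx; have [_] := gx'; rewrite !ler_norml !muE => /andP[k1 k2] /andP[k3 k4].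
  set G := mean_cost p s j true - mean_cost p s j false in k1 k2 k3 k4.
  have hG : 2 / 9 / Num.sqrt L%:R <= G by exact: mean_cost_gap.
  have G0 : 0 <= G by apply: le_trans hG; rewrite !divr_ge0 ?sqrtr_ge0.
  have th0 : 0 < theta.
    have : 0 < theta * (2 / 9 / Num.sqrt L%:R) by apply: lt_trans hgap; nra.
    have [//|le] := ltP 0 theta; rewrite ltNge => /negP[].
    by rewrite mulr_le0_ge0 // !divr_ge0 ?sqrtr_ge0.
  have hdG : theta * n%:R * (2 / 9 / Num.sqrt L%:R) <=
      `|(hdist (Gm g) (H u))%:R - (hdist (Gm g) (H u'))%:R| * G.
    by apply: ler_pM => //; rewrite ?mulr_ge0 ?invr_ge0 ?sqrtr_ge0 ?(ltW th0).
  rewrite -[G in X in _ <= X]ger0_norm // -normrM mulrBl in hdG.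
  have hup : `|(hdist (Gm g) (H u))%:R * G - (hdist (Gm g) (H u'))%:R * G| <=
      (2 * lam + 150 * eps) * n%:R.
    by rewrite ler_norml; apply/andP; split; lra.
  have := le_trans hdG hup; rewrite mulrAC ler_pM2r // leNgt.
  by rewrite hgap.
(* For a fixed message, the masks translated by the codeword bits [eta] are again independent
   uniform coins, so the power is a sum of independent costs over the coordinates. *)
- move=> M s j; pose eta i : C := [ffun x => H (M x) i].
  pose e g i := Gm g i (+) H (M (s, j)) i.
  have normE om g : Lp_norm p (residual (enc om) (qry om s j g) M s) `^ p /
      (4 ^ s)%N%:R `^ p = \sum_i cost p s j (e g i) (xorf (eta i) (om i)).
    rewrite Lp_norm_powR // mulr_suml; apply: eq_bigr => i _.
    have votE s' : (\sum_k increment (H (M (s', k)) i (+) om i (s', k)))%:~R =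
        vote R (xorf (eta i) (om i)) s'.
      by rewrite rmorph_sum /=; apply: eq_bigr => k _; rewrite !ffunE.
    have encE s' : (enc om s' (slice M s') 0 i)%:~R =
        (4 ^ s')%N%:R * digit R (xorf (eta i) (om i)) s'.
      rewrite mxE intrM intr_sg /digit -votE; congr (_ * Num.sg (_%:~R)).
      by apply: eq_bigr => k _; rewrite !ffunE.
    have -> : (residual (enc om) (qry om s j g) M s 0 i)%:~R = (4 ^ s)%N%:R *
        (digit R (xorf (eta i) (om i)) s
         - sigma R (e g i (+) xorf (eta i) (om i) (s, j)) + noise R (xorf (eta i) (om i)) s).
      rewrite residualE rmorphD rmorphB /= encE mulrDr mulrBr; congr (_ - _ + _).
        rewrite mxE intrM; congr (_ * (increment _)%:~R).
        by rewrite !ffunE /e -addbA addKb.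
      rewrite rmorph_sum /= /noise mulr_sumr; apply: eq_bigr => s' _.
      by rewrite encE; field; rewrite gt_eqF.
    by rewrite normrM powRM // ger0_norm ?(ltW (b0 s)) // mulrAC mulfV ?gt_eqF // mul1r.
  pose f g i c := cost p s j (e g i) (xorf (eta i) c) - mean_cost p s j (e g i).
  have f0 g i : \sum_c f g i c = 0.
    rewrite big_split /= sumrN sum_xorf sumr_const -mulr_natr /mean_cost divfK ?subrr //.
    by rewrite gt_eqF // card_coins_gt0.
  have f9 g i c : `|f g i c| <= 9.
    have /andP[m0 m9] := @mean_cost_bounds R p T L s j (e g i) hp.
    have := cost_ge0 p s j (e g i) (xorf (eta i) c).
    have := @cost_le9 R p T L s j (e g i) (xorf (eta i) c) hp.
    by rewrite ler_norml /f; lra.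
  have goodE om g : ~ Good s j (M (s, j)) g
      (Lp_norm p (residual (enc om) (qry om s j g) M s)) ->
      (lam * n%:R <= \sum_i f g i (om i)) \/ (lam * n%:R <= \sum_i - f g i (om i)).
    move=> ng; apply/orP; rewrite sumrN; apply/negPn/negP; rewrite negb_or -!ltNge.
    move=> /andP[a1 a2]; apply: ng; split; first exact: Lp_norm_ge0.
    by rewrite normE /mu -sumrB -/(\sum_i f g i (om i)) ler_norml; apply/andP; split; lra.
  have l18 : 0 < lam <= 18 by lra.
  pose B1 g := [set om : Om | lam * n%:R <= \sum_i f g i (om i)]%SET.
  pose B2 g := [set om : Om | lam * n%:R <= \sum_i - f g i (om i)]%SET.
  have c1 g : #|B1 g|%:R <= #|{: Om}|%:R * expR (- (lam ^+ 2 / 648) * n%:R).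
    by have := hoeffding_count l18 (f0 g) (f9 g); rewrite card_ord.
  have c2 g : #|B2 g|%:R <= #|{: Om}|%:R * expR (- (lam ^+ 2 / 648) * n%:R).
    have := @hoeffding_count R 'I_n C (fun i c => - f g i c) lam l18.
    rewrite card_ord; apply => [i|i c]; last by rewrite normrN.
    by rewrite sumrN f0 oppr0.
  have sub : (#|[set om | ~~ `[< forall g, Good s j (M (s, j)) g
      (Lp_norm p (residual (enc om) (qry om s j g) M s)) >]]%SET| <=
      \sum_g (#|B1 g| + #|B2 g|))%N.
    apply: (@leq_trans #|(\bigcup_g (B1 g :|: B2 g))%SET|).
      apply: subset_leq_card; apply/fintype.subsetP => om.
      rewrite finset.in_set => /asboolPn/existsNP[g /goodE hg].
      apply/finset.bigcupP; exists g => //.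
      by rewrite finset.in_setU !finset.in_set; apply/orP.
    elim/big_rec2 : _ => [|g x y _ h]; first by rewrite cards0.
    apply: leq_trans (leq_card_setU _ _) _; apply: leq_add => //.
    exact: leq_card_setU.
  rewrite -(ler_nat R) natrM.
  (* Union bound over the queries and the two tails; with the factor 8 this makes the 16 in
     [htail]. *)
  apply: (@le_trans _ _ (8 * (\sum_(g : Ga) 2 * (#|{: Om}|%:R * expR (- (lam ^+ 2 / 648) * n%:R))))).
    apply: ler_wpM2l => //; apply: (@le_trans _ _ (\sum_g (#|B1 g| + #|B2 g|))%N%:R).
      by rewrite ler_nat.
    rewrite natr_sum; apply: ler_sum => g _; rewrite natrD.
    by have := c1 g; have := c2 g; lra.
  rewrite sumr_const -mulr_natl.
  have := ler_wpM2l (ler0n R #|{: Om}|) htail; lra.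
Qed.

Lemma truncn_ge_half (R : realType) (x : R) : 1 <= x ->
  (0 < Num.truncn x)%N /\ (Num.truncn x)%:R <= x <= 2 * (Num.truncn x)%:R.
Proof.
move=> x1; have /truncn_itv/andP[h1 h2] : 0 <= x by lra.
have t0 : (0 < Num.truncn x)%N.
  by rewrite -ltnS -(ltr_nat R); apply: le_lt_trans h2.
split=> //; rewrite h1 /=; have : 1 <= (Num.truncn x)%:R :> R by rewrite ler1n.
by rewrite -natr1 in h2; lra.
Qed.

Lemma natr_expn2_le_expR (R : realType) (k : nat) : (2 ^ k)%:R <= expR k%:R :> R.
Proof.
rewrite natrX -[k%:R]mul1r expRM_natr; apply: lerXn2r; rewrite ?nnegrE ?expR_ge0 //.
by apply: le_trans (expR_ge1Dx 1).
Qed.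

(** Here [L] is chosen of order [min (1 / eps^2) (n / a)]: the first term keeps the shift
    [1 / sqrt L] above the approximation error, the second keeps the tail small against [2 ^ (8 a)]
    queries. *)
Lemma small_eps_bound (R : realType) (theta : R) : 0 < theta <= 1 ->
  exists (C0 : nat) (c q : R), 0 < c /\ 0 < q <= 1 /\
  forall (p eps delta : R) (n a W S : nat) (A : rand_alg R n) (U Ga : finType)
    (H : U -> {ffun 'I_n -> bool}) (Gm : Ga -> {ffun 'I_n -> bool}),
  1 <= p <= 2 -> 0 < eps < 1 -> eps <= q -> (0 < n)%N -> (4 <= a)%N ->
  #|U| = (2 ^ (8 * a))%N -> (#|Ga| <= 2 ^ (8 * a))%N ->
  #|Ga|%:R * delta <= 1 / 2 -> a%:R <= q ^+ 2 * n%:R ->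
  (forall u u', u != u' -> exists g,
     theta * n%:R <= `|(hdist (Gm g) (H u))%:R - (hdist (Gm g) (H u'))%:R|) ->
  ((2 * n) ^ C0 <= W)%N -> uses_bits A S -> estimates_Lp A p eps delta W ->
  c * (Num.min (a%:R / eps ^+ 2) n%:R * ln W%:R) <= S%:R.
Proof.
move=> /andP[th0 th1].
have [C0 [cT [cT0 hT]]] := @exists_scale_number R 4 1 isT (ltnSn 0).
have [kap kapE] : exists k : R, k = theta * (2 / 9) by eexists.
(* Once [eps * sqrt L <= q], the approximation error uses at most 150/700 of the available gap
   [kap / sqrt L]; the choice of [lam] below uses another quarter. *)
have [q qE] : exists q : R, q = kap / 700 by eexists.
have kap0 : 0 < kap by lra.
have kap1 : kap <= 1 by lra.
have q0 : 0 < q by lra.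
have q1 : q <= 1 by lra.
have q20 : 0 < q ^+ 2 by rewrite exprn_gt0.
exists C0, (q ^+ 2 * cT / 8), q; split.
  by rewrite divr_gt0 // mulr_gt0 // exprn_gt0.
split; first by rewrite q0 q1.
move=> p eps delta n a W S A U Ga H Gm hp he eq n0 ha cU cGa hGa haq hsep hW hS hA.
have /andP[e0 e1] := he.
have [T [hTW hcT]] := hT _ _ n0 hW.
have a0 : 0 < a%:R :> R by rewrite ltr0n; apply: leq_trans ha.
have nR : 0 < n%:R :> R by rewrite ltr0n.
have E0 : 0 < eps ^+ 2 by rewrite exprn_gt0.
have [mn mnE] : exists m : R, m = Num.min (a%:R / eps ^+ 2) n%:R by eexists.
have mna : mn <= a%:R / eps ^+ 2 by rewrite mnE ge_min lexx.
have mnn : mn <= n%:R by rewrite mnE ge_min lexx orbT.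
have mn0 : 0 <= mn by rewrite mnE le_min ler0n divr_ge0 ?sqr_ge0.
(* [L] is the integer part of [x]; the assumptions [eps <= q] and [a <= q^2 n] make it positive. *)
pose x := q ^+ 2 * (mn / a%:R).
have x1 : 1 <= x.
  rewrite /x mulrA ler_pdivlMr // mul1r mnE minEle; case: ifP => _; last exact: haq.
  rewrite mulrA ler_pdivlMr // mulrC ler_pM2r // lerXn2r // nnegrE.
    exact: ltW.
  exact: ltW.
have [] := truncn_ge_half x1; set L := Num.truncn x => L0 /andP[Lx xL].
have LR : 0 < L%:R :> R by rewrite ltr0n.
pose b : R := Num.sqrt L%:R.
have b0 : 0 < b by rewrite sqrtr_gt0.
have b2 : b ^+ 2 = L%:R by rewrite sqr_sqrtr.
have Lmn : L%:R * a%:R <= q ^+ 2 * mn.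
  by move: Lx; rewrite /x mulrA ler_pdivlMr.
have bq : b * eps <= q.
  have be0 : 0 <= b * eps by rewrite mulr_ge0 // ltW.
  rewrite -(@ler_pXn2r _ 2) ?nnegrE //; last exact: ltW.
  rewrite exprMn b2 -ler_pdivlMr // -(ler_pM2r a0); apply: (le_trans Lmn).
  have -> : q ^+ 2 / eps ^+ 2 * a%:R = q ^+ 2 * (a%:R / eps ^+ 2) by rewrite mulrAC mulrA.
  by rewrite ler_pM2l.
have Ln : L%:R * a%:R <= q ^+ 2 * n%:R.
  by apply: (le_trans Lmn); rewrite ler_pM2l.
have [lam lamE] : exists l : R, l = kap / (8 * b) by eexists.
have lam0 : 0 < lam by rewrite lamE divr_gt0 // mulr_gt0.
have b1 : 1 <= b by rewrite -(@ler_pXn2r _ 2) ?nnegrE ?expr1n ?b2 ?ler1n // ltW.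
have hbound : (a * (T * L) <= 4 * S)%N.
  apply: (@superposition_bound R p eps delta lam theta n a L T W S A U Ga H Gm
    hp he n0 ha cU hGa _ _ hsep _ hTW hS hA).
  - rewrite lam0 /= lamE ler_pdivrMr ?mulr_gt0 // mul1r; lra.
  (* Enough for the union bound, since [16 * 2 ^ (8 a)] is at most [expR (4 + 8 a)] and [4 <= a];
     the factor [700^2 / (64 * 648)] exceeds 9. *)
  - have hX : 9 * a%:R <= lam ^+ 2 / 648 * n%:R.
      have -> : lam ^+ 2 / 648 * n%:R = (700 * 700 / (64 * 648)) * (q ^+ 2 * n%:R / L%:R).
        by rewrite -b2 lamE qE; field; rewrite gt_eqF.
      have : a%:R <= q ^+ 2 * n%:R / L%:R by rewrite ler_pdivlMr // mulrC.
      set y := q ^+ 2 * n%:R / L%:R => hy; lra.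
    have h16 : 16 * #|Ga|%:R <= expR (4 + 8 * a)%N%:R :> R.
      apply: le_trans (natr_expn2_le_expR R _).
      by rewrite expnD natrM ler_wpM2l // ler_nat.
    apply: (@le_trans _ _ (expR (4 + 8 * a)%N%:R * expR (- (lam ^+ 2 / 648) * n%:R))).
      by apply: ler_wpM2r; [exact: expR_ge0 | exact: h16].
    rewrite -expRD -[leRHS]expR0 ler_expR mulNr natrD natrM.
    have : 4 <= a%:R :> R by rewrite ler_nat.
    by lra.
  - rewrite -/b mulrA -kapE ltr_pdivlMr // mulrDl.
    have -> : 2 * lam * b = kap / 4 by rewrite lamE; field; rewrite gt_eqF.
    have -> : 150 * eps * b = 150 * (b * eps) by ring.
    have : 700 * q = kap by rewrite qE; field.
    by lra.
have lnW : 0 <= ln W%:R :> R.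
  rewrite ln_ge0 // ler1n; apply: leq_trans hTW.
  by rewrite !muln_gt0 expn_gt0 n0.
have hb : a%:R * (T%:R * L%:R) <= 4 * S%:R :> R by rewrite -!natrM ler_nat.
have hm : q ^+ 2 * mn <= 2 * (a%:R * L%:R).
  move: xL; rewrite /x mulrA ler_pdivrMr //; lra.
rewrite -mnE.
have h1 : q ^+ 2 * mn * (cT * ln W%:R) <= 2 * (a%:R * L%:R) * T%:R.
  apply: ler_pM => //; last by rewrite mulr_ge0 // ltW.
  by rewrite mulr_ge0 // ltW.
by lra.
Qed.

(** * The lower bound *)

(** The word of level [u] is true on its first [u * w] coordinates with [w = n %/ Q], so its
    distance from the zero word reveals [u]. From [Q <= n] one gets [w >= n / (2 Q)]. *)
Lemma thermometer_code (R : realType) (n Q : nat) : (0 < Q)%N -> (Q <= n)%N ->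
  exists H : 'I_Q -> {ffun 'I_n -> bool}, forall u u', u != u' ->
    exists g : unit, 1 / (2 * Q%:R) * n%:R <=
      `|(hdist [ffun=> false] (H u))%:R - (hdist [ffun=> false] (H u'))%:R| :> R.
Proof.
move=> Q0 hQ; set w := (n %/ Q)%N.
exists (fun u => [ffun i : 'I_n => (i < u * w)%N]) => u u' ne; exists tt.
have hd (v : 'I_Q) : hdist [ffun=> false] [ffun i : 'I_n => (i < v * w)%N] = (v * w)%N.
  have le : (v * w <= n)%N.
    apply: leq_trans (leq_divM n Q); rewrite mulnC leq_mul2l.
    by apply/orP; right; apply: ltnW.
  rewrite /hdist -sum1_card big_mkcond /=.
  rewrite (eq_bigr (fun i : 'I_n => if (i < v * w)%N then 1%N else 0%N)).
    by rewrite -big_mkcond -(big_ord_widen _ (fun=> 1%N) le) sum1_card card_ord.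
  by move=> i _; rewrite finset.in_set !ffunE; case: (_ < _)%N.
have QR : 0 < Q%:R :> R by rewrite ltr0n.
have hw : 1 / (2 * Q%:R) * n%:R <= w%:R :> R.
  rewrite mulrAC mul1r ler_pdivrMr ?mulr_gt0 // -!natrM ler_nat.
  have w1 : (0 < w)%N by rewrite divn_gt0.
  have := ltn_ceil n Q0; rewrite -/w => lt.
  by apply: leq_trans (ltnW lt) _; rewrite mulnCA mulnA leq_mul2r; apply/orP; right; lia.
rewrite !hd; apply: (le_trans hw).
wlog lt : u u' ne / (u < u')%N => [hwlog|].
  move: (ne); rewrite neq_ltn => /orP[|] h; first exact: hwlog.
  by rewrite distrC; apply: hwlog; rewrite // eq_sym.
rewrite distrC -natrB ?leq_mul2r ?(ltnW lt) ?orbT // ger0_norm // ler_nat -mulnBl.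
by rewrite leq_pmull // subn_gt0.
Qed.

Lemma exists_common_bound (a b c d : nat) :
  exists e, [/\ (0 < e)%N, (a <= e)%N, (b <= e)%N, (c <= e)%N & (d <= e)%N].
Proof. by exists (a + b + c + d).+1; split; lia. Qed.

Theorem theorem7p1p4 (R : realType) :
  exists C0 : R, 0 < C0 /\
  exists c : R, 0 < c /\
  forall (p eps delta : R) (n W S : nat) (A : rand_alg R n),
    1 <= p <= 2 ->
    0 < eps < 1 ->
    0 < delta < 1 / 2 ->
    (0 < n)%N ->
    (n%:R / delta) `^ C0 <= W%:R ->
    uses_bits A S ->
    estimates_Lp A p eps delta W ->
    c * (Num.min (eps ^- 2 * ln (1 / delta)) n%:R * ln W%:R) <= S%:R.
Proof.
have [a0 ha0] : exists a : nat, (4 <= a)%N by exists 4%N.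
have a0R : 4 <= a0%:R :> R by rewrite ler_nat.
have [Q QE] : exists Q : nat, Q = (2 ^ (8 * a0))%N by eexists.
have Q0 : (0 < Q)%N by rewrite QE expn_gt0.
have Q1 : 1 <= Q%:R :> R by rewrite ler1n.
have [C1 [c1 [c10 H1]]] := one_coordinate_bound R ha0.
have [C2 [c2 [c20 H2]]] := large_eps_bound R.
have th1 : 0 < (1 / (2 * Q%:R) : R) <= 1.
  have tq : 0 < 2 * Q%:R :> R by lra.
  by apply/andP; split; [rewrite divr_gt0 | rewrite ler_pdivrMr //; lra].
have [C3 [c3 [q3 [c30 [/andP[q30 q31] H3]]]]] := small_eps_bound th1.
have th2 : 0 < (1 / 16 : R) <= 1 by lra.
have [C4 [c4 [q4 [c40 [/andP[q40 q41] H4]]]]] := small_eps_bound th2.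
have [C0 [C00 L1 L2 L3 L4]] := exists_common_bound C1 C2 C3 C4.
have q3s : 0 < q3 ^+ 2 by rewrite exprn_gt0.
have q4s : 0 < q4 ^+ 2 by rewrite exprn_gt0.
have [nu [nu0 nuq nu32]] : exists nu : R, [/\ 0 < nu, nu <= q4 ^+ 2 & 32 * nu <= 1].
  exists (q4 ^+ 2 / 32); have hq : q4 ^+ 2 <= 1 by rewrite expr_le1 // ltW.
  by clear -q4s hq; split; lra.
(* Beyond [N0] the thermometer fits ([Q <= n]), [a0 <= q3^2 n] holds, and [nu n >= 4]. *)
have [N0 N0E] : exists N : R, N = Q%:R + a0%:R / q3 ^+ 2 + 4 / nu by eexists.
have aq0 : 0 < a0%:R / q3 ^+ 2 by rewrite divr_gt0 //; apply: lt_le_trans a0R.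
have fn0 : 0 < 4 / nu by rewrite divr_gt0.
have N00 : 0 < N0 by clear -N0E Q1 aq0 fn0; lra.
have [K KE] : exists K : R, K = 9 / q4 ^+ 2 + 1 / nu by eexists.
have K1 : 0 < 9 / q4 ^+ 2 by rewrite divr_gt0.
have K2 : 0 < 1 / nu by rewrite divr_gt0.
have K0 : 0 < K by rewrite KE addr_gt0.
have [D DE] : exists D : R, D = 18 + 2 / nu by eexists.
have D1 : 0 < 2 / nu by rewrite divr_gt0.
have D0 : 0 < D by rewrite DE addr_gt0.
exists C0%:R; split; first by rewrite ltr0n.
pose c := Num.min (c1 / N0) (Num.min (c1 * q3 ^+ 2 / 36)
  (Num.min (c3 / 36) (Num.min (c2 / (2 * K)) (c4 / D)))).
have [cA cB1 cB2 cC1 cC2] : [/\ c <= c1 / N0, c <= c1 * q3 ^+ 2 / 36, c <= c3 / 36,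
    c <= c2 / (2 * K) & c <= c4 / D].
  by split; rewrite /c !ge_min lexx ?orbT.
have cpos : 0 < c.
  by rewrite /c !lt_min !divr_gt0 ?mulr_gt0.
move: c cA cB1 cB2 cC1 cC2 cpos => c cA cB1 cB2 cC1 cC2 cpos.
exists c; split=> // p eps delta n W S A hp he hd n0 hW hS hA.
have /andP[e0 e1] := he; have /andP[d0 d1] := hd.
have nR : 1 <= n%:R :> R by rewrite ler1n.
(* As [delta < 1 / 2], the ratio [n / delta] is at least [2 n]. *)
have W2n : ((2 * n) ^ C0 <= W)%N.
  rewrite -(ler_nat R) natrX; apply: le_trans hW.
  rewrite -powR_mulrn //; apply: le_powR => //.
  by rewrite natrM ler_pdivlMr //; clear -d0 d1 nR; nra.
have Wi Ci : (Ci <= C0)%N -> ((2 * n) ^ Ci <= W)%N.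
  move=> le; apply: leq_trans W2n; apply: leq_pexp2l => //.
  by rewrite muln_gt0.
have lnW : 0 <= ln W%:R :> R.
  by rewrite ln_ge0 // ler1n; apply: leq_trans (Wi 0%N (leq0n _)).
have [k kE] : exists k : R, k = ln (1 / delta) by eexists.
have k0 : 0 < k by rewrite kE ln_gt0 // ltr_pdivlMr //; clear -d0 d1; lra.
have E0 : 0 < eps ^+ 2 by rewrite exprn_gt0.
rewrite -kE mulrC [eps ^- 2 * k]mulrC.
have [m mE] : exists m : R, m = Num.min (k / eps ^+ 2) n%:R by eexists.
rewrite -mE.
have mk : m <= k / eps ^+ 2 by rewrite mE ge_min lexx.
have mn : m <= n%:R by rewrite mE ge_min lexx orbT.
have m0 : 0 <= m by rewrite mE le_min ler0n divr_ge0 // ltW.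
(* Every case ends here: a bound with [X] in place of [m] suffices when [m <= Y * X], at the cost of
   the constant [Y]. *)
have fin ci X Y : c <= ci / Y -> 0 < ci -> 0 < Y -> m <= Y * X -> ci * (X * ln W%:R) <= S%:R ->
    m * ln W%:R * c <= S%:R.
  move=> hc ci0 Y0 hm hX; apply: le_trans hX.
  apply: (@le_trans _ _ (m * ln W%:R * (ci / Y))).
    by apply: ler_wpM2l => //; rewrite mulr_ge0.
  have -> : m * ln W%:R * (ci / Y) = ci * (m / Y * ln W%:R) by field; rewrite gt_eqF.
  rewrite ler_pM2l //; apply: ler_wpM2r => //.
  by rewrite ler_pdivrMr // mulrC.
have hI : c1 * (1 * ln W%:R) <= S%:R.
  by rewrite mul1r; apply: (H1 p eps delta n W S A hp he hd n0 (Wi _ L1) hS hA).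
have [nle|ngt] := leP n%:R N0.
  by apply: (fin c1 1 N0 cA c10 N00 _ hI); rewrite mulr1; apply: le_trans mn _.
(* For [k < 36] the logarithm of [1 / delta] is bounded: either [eps] exceeds [q3] and [m] is
   bounded too, or a fixed alphabet read with one query per symbol is enough. The threshold is
   [4 * 9], so that otherwise [k / 9 >= 4]. *)
have [k36|k36] := ltP k 36.
  have [eq3|eq3] := leP eps q3; last first.
    have : m <= 36 / q3 ^+ 2.
      apply: (le_trans mk); rewrite ler_pdivrMr // mulrAC ler_pdivlMr //.
      apply: ler_pM; [exact: ltW | exact: ltW | exact: ltW |].
      by apply: lerXn2r; rewrite ?nnegrE; exact: ltW.
    move=> hm; apply: (fin c1 1 (36 / q3 ^+ 2)) => //.
    - by rewrite invf_div mulrA.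
    - by rewrite divr_gt0.
    - by rewrite mulr1.
  have Qn : (Q <= n)%N by rewrite -(ler_nat R); clear -N0E ngt aq0 fn0; lra.
  have [H hH] := thermometer_code R Q0 Qn.
  have h3 : c3 * (Num.min (a0%:R / eps ^+ 2) n%:R * ln W%:R) <= S%:R.
    apply: (H3 p eps delta n a0 W S A 'I_Q unit H (fun=> [ffun=> false]) hp he eq3 n0 ha0
      _ _ _ _ hH (Wi _ L3) hS hA).
    - by rewrite card_ord QE.
    - by rewrite card_unit expn_gt0.
    - by rewrite card_unit; clear -d1; lra.
    - by rewrite mulrC -ler_pdivrMr //; clear -N0E ngt Q1 fn0; lra.
  apply: (fin c3 (Num.min (a0%:R / eps ^+ 2) n%:R) 36 cB2 c30 _ _ h3) => //.
  rewrite minr_pMr // le_min; apply/andP; split; last by clear -mn nR; lra.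
  by apply: (le_trans mk); rewrite mulrA ler_pM2r ?invr_gt0 //; clear -k36 a0R; lra.
(* The integer part [a] of [x] sets the symbol length [8 a]. The bound [k / 9] gives [1 + 8 a <= k],
   hence [2 ^ (8 a) * delta <= 1 / 2]; the bound [nu n] leaves room for the code and the
   concentration. *)
have [x xE] : exists x : R, x = Num.min (k / 9) (nu * n%:R) by eexists.
have x4 : 4 <= x.
  have : 4 / nu <= n%:R by clear -N0E ngt Q1 aq0; lra.
  by rewrite ler_pdivrMr // mulrC xE le_min => ->; rewrite andbT; clear -k36; lra.
have xk : x <= k / 9 by rewrite xE ge_min lexx.
have xn : x <= nu * n%:R by rewrite xE ge_min lexx orbT.
have [] := @truncn_ge_half R x; first by clear -x4; lra.
move: (Num.truncn x) (truncn_itv (le_trans (ler0n R 4) x4)) => a /andP[_ xlt] apos /andP[ax xa].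
have ha : (4 <= a)%N by rewrite -ltnS -(ltr_nat R); apply: le_lt_trans xlt.
have aR : 4 <= a%:R :> R by rewrite ler_nat.
have h2d : (2 ^ (8 * a))%:R * delta <= 1 / 2.
  have hk : expR k = 1 / delta by rewrite kE lnK // posrE divr_gt0.
  have := natr_expn2_le_expR R (1 + 8 * a).
  rewrite expnD natrM expn1 natrD natrM => h.
  have : expR (1 + 8 * a%:R) <= expR k by rewrite ler_expR; clear -ax xk aR; lra.
  rewrite hk => h'; have := le_trans h h'; rewrite ler_pdivlMr //; clear; lra.
have an32 : (32 * a <= n)%N.
  rewrite -(ler_nat R) natrM; have h : nu * n%:R * 32 <= n%:R by clear -nu32 nR; nra.
  by clear -h ax xn; lra.
have [eq4|eq4] := leP eps q4; last first.
  have h2 : c2 * (a%:R * ln W%:R) <= S%:R.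
    exact: (H2 p eps delta n a W S A hp he n0 ha an32 h2d (Wi _ L2) hS hA).
  apply: (fin c2 a%:R (2 * K) cC1 c20 _ _ h2); first by rewrite mulr_gt0.
  (* Each summand of [K] serves one argument of the minimum: [m <= k / q4^2] for [k / 9], and
     [m <= n] for [nu n]. *)
  have hK : m <= K * x.
    have mK1 : m <= K * (k / 9).
      have mq : m <= k / q4 ^+ 2.
        apply: (le_trans mk); rewrite ler_pM2l // lef_pV2 ?posrE //.
        by apply: lerXn2r; rewrite ?nnegrE; exact: ltW.
      apply: (le_trans mq).
      have -> : K * (k / 9) = k / q4 ^+ 2 + 1 / nu * (k / 9).
        by rewrite KE; field; rewrite !gt_eqF.
      by rewrite lerDl mulr_ge0 ?divr_ge0 // ltW.
    have mK2 : m <= K * (nu * n%:R).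
      apply: (le_trans mn).
      have -> : K * (nu * n%:R) = n%:R + 9 / q4 ^+ 2 * (nu * n%:R).
        by rewrite KE; field; rewrite !gt_eqF.
      by rewrite lerDl !mulr_ge0 ?invr_ge0 // ltW.
    by rewrite xE minr_pMr ?le_min ?mK1 ?mK2 // ltW.
  have hK2 : K * x <= K * (2 * a%:R) by rewrite ler_pM2l.
  by clear -hK hK2; lra.
have h4 : (4 * (8 * a) <= n)%N by rewrite mulnA.
have [H hH] := gilbert_varshamov h4 (leqnn _).
have hm : c4 * (Num.min (a%:R / eps ^+ 2) n%:R * ln W%:R) <= S%:R.
  apply: (H4 p eps delta n a W S A _ _ H H hp he eq4 n0 ha _ _ _ _ _ (Wi _ L4) hS hA).
  - by rewrite card_ord.
  - by rewrite card_ord.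
  - by rewrite card_ord.
  - have h : nu * n%:R <= q4 ^+ 2 * n%:R by rewrite ler_pM2r // ltr0n.
    by clear -h ax xn; lra.
  - move=> u u' ne; exists u.
    have -> : hdist (H u) (H u) = 0%N.
      by apply: eq_card0 => i; rewrite finset.in_set eqxx.
    rewrite sub0r normrN ger0_norm //.
    have := hH _ _ ne; rewrite -(ltr_nat R) natrM; clear; lra.
apply: (fin c4 (Num.min (a%:R / eps ^+ 2) n%:R) D cC2 c40 D0 _ hm).
rewrite minr_pMr ?(ltW D0) // le_min; apply/andP; split; last by clear -DE D1 mn nR; nra.
have aE : a%:R <= a%:R / eps ^+ 2.
  rewrite ler_pdivlMr // ler_piMr // expr_le1 // ltW //.
have -> : D * (a%:R / eps ^+ 2) = 18 * (a%:R / eps ^+ 2) + 2 / nu * (a%:R / eps ^+ 2).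
  by rewrite DE mulrDl.
have hD2 : 2 / nu * a%:R <= 2 / nu * (a%:R / eps ^+ 2) by rewrite ler_pM2l.
have ae0 : 0 <= a%:R / eps ^+ 2 by rewrite divr_ge0 // ltW.
(* If [x = k / 9], then [k <= 18 a] gives [m <= 18 a / eps^2]. If [x = nu n], then
   [m <= n <= (2 / nu) a]. The constant [D] is the sum of both factors. *)
move: xa; rewrite xE minEle; case: ifP => _ xa.
  have : k / 9 / eps ^+ 2 <= 2 * a%:R / eps ^+ 2 by rewrite ler_pM2r ?invr_gt0.
  have -> : 2 * a%:R / eps ^+ 2 = 2 * (a%:R / eps ^+ 2) by rewrite mulrA.
  have -> : k / 9 / eps ^+ 2 = k / eps ^+ 2 / 9 by rewrite mulrAC.
  have h0 : 0 <= 2 / nu * (a%:R / eps ^+ 2) by rewrite mulr_ge0 // ltW.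
  by clear -mk h0; lra.
have hn : n%:R <= 2 / nu * a%:R.
  by rewrite mulrAC ler_pdivlMr // mulrC.
by clear -mn hn hD2 ae0; lra.
Qed.
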